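(* For all $\Gamma\subseteq\{0,1\}^\infty$, $$\mathrm{dim}(\Gamma)=\inf \mathscr G_{\mathrm{constr}}(\Gamma),$$ where $\mathrm{dim}(\Gamma)$ is the algorithmic dimension of $\Gamma$ and $\mathscr G_{\mathrm{constr}}(\Gamma)=\{s\in[0,\infty) : \text{there exists a learning function } l \text{ which algorithmically } s\text{-learns every } X\in\Gamma\}$.
   Context: For $s\in[0,\infty)$, an $s$-gale is a function $d:\{0,1\}^*\to[0,\infty)$ with $d(w)2^{-s|w|}=d(w0)2^{-s(|w|+1)}+d(w1)2^{-s(|w|+1)}$ for all $w$. A function $f:\{0,1\}^*\to[0,\infty)$ is lower semicomputable if there is a computable $g:\{0,1\}^*\times\mathbb N\to\mathbb Q\cap[0,\infty)$ with $g(w,t)\le g(w,t+1)\le f(w)$ and $\lim_t g(w,t)=f(w)$ for all $w,t$. A gale $d$ succeeds on $X$ if $\limsup_n d(X\upharpoonright n)=\infty$. The algorithmic dimension of $\Gamma$ is $\mathrm{dim}(\Gamma)=\inf\{s\in[0,\infty): \text{some lower semicomputable } s\text{-gale succeeds on every } X\in\Gamma\}$. A learning function is a function $l:\{0,1\}^*\to\{0,1\}$ (yes $=1$, no $=0$). $Y\upharpoonright i$ is the length-$i$ prefix of $Y$; $\lambda$ is the uniform (Lebesgue) measure on $\{0,1\}^\infty$. For nonempty $w$, $\mathrm{AVG}_l(w)=\frac{1}{|w|}\sum_{i=0}^{|w|} l(w\upharpoonright i)$. For $s\ge 0$, $l$ algorithmically $s$-learns $X$ iff: (1) the map $w\mapsto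 \mathrm{AVG}_l(w)$ is lower semicomputable (uniformly in $w$); (2) for all $n\in\mathbb N$, $\lambda(\{Y : \#\{i\in\mathbb N: l(Y\upharpoonright i)=1\}\ge n\})\le 2^{-n}$; (3) $\limsup_{n\to\infty}\mathrm{AVG}_l(X\upharpoonright n)\ge 1-s$. *)

(* Defs.v *)
From HB Require Import structures.
From mathcomp Require Import all_boot all_order all_algebra.
From mathcomp Require Import all_classical all_reals all_analysis.
Set Implicit Arguments. Unset Strict Implicit. Unset Printing Implicit Defensive.
Import Order.TTheory GRing.Theory Num.Theory numFieldNormedType.Exports.
Local Open Scope classical_set_scope.
Local Open Scope ring_scope.

Inductive murec : Type :=
| MZero : murec
| MSucc : murec
| MProj : nat -> murec
| MComp : murec -> list murec -> murec
| MPrec : murec -> murec -> murec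
| MMin  : murec -> murec.

Inductive mu_eval : murec -> seq nat -> nat -> Prop :=
| ev_zero v : mu_eval MZero v 0
| ev_succ x v : mu_eval MSucc (x :: v) x.+1
| ev_proj i v : (i < size v)%N -> mu_eval (MProj i) v (nth 0%N v i)
| ev_comp f gs v ys y :
    mu_evals gs v ys -> mu_eval f ys y -> mu_eval (MComp f gs) v y
| ev_prec0 f g v y : mu_eval f v y -> mu_eval (MPrec f g) (0%N :: v) y
| ev_precS f g n v r y :
    mu_eval (MPrec f g) (n :: v) r -> mu_eval g (n :: r :: v) y ->
    mu_eval (MPrec f g) (n.+1 :: v) y
| ev_min f v n :
    mu_eval f (n :: v) 0 ->
    (forall m, (m < n)%N -> exists k, mu_eval f (m :: v) k.+1) ->
    mu_eval (MMin f) v n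
with mu_evals : list murec -> seq nat -> seq nat -> Prop :=
| evs_nil v : mu_evals nil v [::]
| evs_cons g gs v y ys :
    mu_eval g v y -> mu_evals gs v ys -> mu_evals (g :: gs) v (y :: ys).

Definition computable_nat (f : nat -> nat) : Prop :=
  exists p : murec, forall n, mu_eval p [:: n] (f n).

(* A function between countable types is computable if it is computable
   modulo the standard (effective) codings [pickle] of the countTypes. *)
Definition computable (A B : countType) (f : A -> B) : Prop :=
  exists h : nat -> nat, computable_nat h /\
    forall a, h (pickle a) = pickle (f a).

Definition prefix (X : nat -> bool) (n : nat) : seq bool := mkseq X n.

Definition lower_semicomputable (R : realType) (f : seq bool -> R) : Prop :=
  exists g : seq bool * nat -> rat,
    computable g /\
    forall w t, [/\ 0 <= g (w, t),
                    g (w, t) <= g (w, t.+1),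
                    ratr (g (w, t)) <= f w
                  & (fun t => ratr (g (w, t)) : R) @ \oo --> f w].

Definition is_gale (R : realType) (s : R) (d : seq bool -> R) : Prop :=
  (forall w, 0 <= d w) /\
  forall w : seq bool,
    d w * powR 2 (- (s * (size w)%:R)) =
      d (rcons w false) * powR 2 (- (s * (size w).+1%:R))
    + d (rcons w true) * powR 2 (- (s * (size w).+1%:R)).

Definition gale_succeeds (R : realType) (d : seq bool -> R) (X : nat -> bool) : Prop :=
  limn_esup (fun n => (d (prefix X n))%:E) = +oo%E.

Definition dim_set (R : realType) (Gamma : set (nat -> bool)) : set R :=
  [set s : R | 0 <= s /\
     exists d : seq bool -> R, [/\ is_gale s d, lower_semicomputable d
                                  & forall X, Gamma X -> gale_succeeds d X]].

Definition alg_dim (R : realType) (Gamma : set (nat -> bool)) : \bar R :=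
  ereal_inf [set s%:E | s in @dim_set R Gamma].

(* Uniform (Lebesgue) measure on Cantor space, as the outer measure    *)
(* induced by cylinders: inf of sum 2^-|w_k| over countable covers.    *)
Definition cyl_cover (A : set (nat -> bool)) (C : nat -> seq bool) : Prop :=
  forall Y, A Y -> exists k, prefix Y (size (C k)) = C k.

Definition cantor_lambda (R : realType) (A : set (nat -> bool)) : \bar R :=
  ereal_inf [set (\sum_(0 <= k <oo) ((2%:R : R) ^- (size (C k)))%:E)%E
            | C in cyl_cover A].

Definition learning_function := seq bool -> bool.

(* AVG_l(w) = 1/|w| * sum_{i=0}^{|w|} l(w|i); for w empty this is 0
   (since 1/0 = 0 in MathComp). *)
Definition AVG (R : realType) (l : learning_function) (w : seq bool) : R :=
  (size w)%:R^-1 * \sum_(0 <= i < (size w).+1) ((l (take i w))%:R : R).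

Definition many_yes (l : learning_function) (n : nat) (Y : nat -> bool) : Prop :=
  exists s : seq nat, [/\ uniq s, (n <= size s)%N & all (fun i => l (prefix Y i)) s].

Definition alg_s_learns (R : realType) (s : R) (l : learning_function)
    (X : nat -> bool) : Prop :=
  [/\ lower_semicomputable (@AVG R l),
      (forall n : nat, (@cantor_lambda R (many_yes l n) <= ((2%:R : R) ^- n)%:E)%E)
    & (limn_esup (fun n => (@AVG R l (prefix X n))%:E) >= (1 - s)%:E)%E].

Definition G_constr (R : realType) (Gamma : set (nat -> bool)) : set R :=
  [set s : R | 0 <= s /\
     exists l : learning_function, forall X, Gamma X -> alg_s_learns s l X].

(* Main.v *)
Require Import Defs.
From HB Require Import structures.
From mathcomp Require Import all_boot all_order all_algebra.
From mathcomp Require Import all_classical all_reals all_analysis.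
From mathcomp Require Import zify ring lra.
Set Implicit Arguments. Unset Strict Implicit. Unset Printing Implicit Defensive.
Import Order.TTheory GRing.Theory Num.Theory numFieldNormedType.Exports Defs.
Local Open Scope classical_set_scope.
Local Open Scope ring_scope.

(** From learning to gales: the strings [v] with [AVG_l v > q] form an enumerable set
    with at most [2 ^ ((1 - q) n)] members of length [n], because each of them starts a
    cylinder on which [l] says yes more than [q n] times.  With
    [2 ^ (1 - q) < rho < r] and [r] rational, [r ^ |w|] times the sum over these [v] of
    [(2 / rho) ^ |v|] times the measure of the intersection of the cylinders of [v]
    and [w] is a gale of order [log2 r] which is at least [(r / rho) ^ |v|] at each [v].
    Choosing the base [r] rational, rather than the order, keeps all its approximations
    rational.

    From gales to learning: if [d] is an [s]-gale, the enumerable set [d v > 1] has at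
    most [2 ^ (s n) d(empty)] members of length [n], so for [q < 1 - s] and a large
    constant [c] the learner can afford to say yes at the last [floor (q |v|) - c]
    prefixes of each member [v].  This learner need not be computable, but the number
    of its yes answers along a string is a maximum over an enumerable set. *)

(** * Computable functions of several variables *)

Section Computability.
Local Open Scope nat_scope.

(* De Bruijn contexts: the most recently bound variable is the last component of
   the nested pairs and the head of the argument list. *)
Fixpoint ctx (n : nat) : Type := if n is n'.+1 then (ctx n' * nat)%type else unit.

Fixpoint args n : ctx n -> seq nat :=
  match n with
  | 0 => fun=> [::]
  | n'.+1 => fun e => e.2 :: args e.1
  end.

Lemma size_args n (e : ctx n) : size (args e) = n.
Proof. by elim: n e => //= n IHn [e x] /=; rewrite IHn. Qed.

(** Only the result is coded by [pickle]; the arguments stay a list of numbers, so programs compose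
    without decoding. *)
Definition rec n (B : countType) (f : ctx n -> B) :=
  exists p, forall e, mu_eval p (args e) (pickle (f e)).

Lemma eq_rec n (B : countType) (f g : ctx n -> B) : f =1 g -> rec f -> rec g.
Proof. by move=> fg [p hp]; exists p => e; rewrite -fg. Qed.

(** This and its converse hold by computation, because [pickle] on [nat] is the identity. *)
Lemma rec_pickle n (B : countType) (f : ctx n -> B) :
  rec f -> rec (fun e => pickle (f e)).
Proof. by []. Qed.

Lemma rec_unpickle n (B : countType) (f : ctx n -> B) :
  rec (fun e => pickle (f e)) -> rec f.
Proof. by []. Qed.

Fixpoint recs n k : (ctx n -> ctx k) -> Prop :=
  match k with
  | 0 => fun=> True
  | k'.+1 => fun s => recs (fun e => (s e).1) /\ rec (fun e => (s e).2)
  end.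

Lemma rec_subst n k (B : countType) (f : ctx k -> B) (s : ctx n -> ctx k) :
  rec f -> recs s -> rec (fun e => f (s e)).
Proof.
move=> [p hp] hs.
suff [gs hgs] : exists gs, forall e, mu_evals gs (args e) (args (s e)).
  by exists (MComp p gs) => e; apply: ev_comp (hgs e) (hp _).
elim: k s hs {f p hp} => [|k IHk] s /=; first by exists nil => e; constructor.
move=> [/IHk [gs hgs] [p hp]]; exists (p :: gs) => e.
by constructor; [exact: hp | exact: hgs].
Qed.

Lemma rec_proj n i : i < n -> rec (fun e : ctx n => nth 0 (args e) i).
Proof. by move=> ltin; exists (MProj i) => e; constructor; rewrite size_args. Qed.

Lemma rec_v0 n : rec (fun e : ctx n.+1 => e.2).
Proof. exact: (@rec_proj n.+1 0). Qed.
Lemma rec_v1 n : rec (fun e : ctx n.+2 => e.1.2).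
Proof. exact: (@rec_proj n.+2 1). Qed.
Lemma rec_v2 n : rec (fun e : ctx n.+3 => e.1.1.2).
Proof. exact: (@rec_proj n.+3 2). Qed.
Lemma rec_v3 n : rec (fun e : ctx n.+4 => e.1.1.1.2).
Proof. exact: (@rec_proj n.+4 3). Qed.
Lemma rec_v4 n : rec (fun e : ctx n.+4.+1 => e.1.1.1.1.2).
Proof. exact: (@rec_proj n.+4.+1 4). Qed.
Lemma rec_v5 n : rec (fun e : ctx n.+4.+2 => e.1.1.1.1.1.2).
Proof. exact: (@rec_proj n.+4.+2 5). Qed.

Lemma mu_evals_proj a m v : a + m <= size v ->
  mu_evals [seq MProj i | i <- iota a m] v (take m (drop a v)).
Proof.
elim: m a => [|m IHm] a le_am /=; first by rewrite take0; constructor.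
have lt_a : a < size v by lia.
rewrite (drop_nth 0 lt_a) /=; constructor; first by constructor.
by apply: IHm; lia.
Qed.

Lemma rec_weak n (B : countType) (f : ctx n -> B) :
  rec f -> rec (fun e : ctx n.+1 => f e.1).
Proof.
move=> [p hp]; exists (MComp p [seq MProj i | i <- iota 1 n]) => -[e x] /=.
apply: ev_comp (hp e).
have := @mu_evals_proj 1 n (x :: args e); rewrite /= drop0 take_oversize ?size_args //.
by apply.
Qed.

Lemma rec_weak2 n (B : countType) (f : ctx n -> B) :
  rec f -> rec (fun e : ctx n.+2 => f e.1.1).
Proof. by move=> hf; exact: (rec_weak (f := fun e : ctx n.+1 => f e.1) (rec_weak hf)). Qed.

Lemma recsP n k (s : ctx n -> ctx k) :
  (forall i, i < k -> rec (fun e => nth 0 (args (s e)) i)) -> recs s.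
Proof.
elim: k s => //= k IHk s hs; split; last exact: (hs 0).
by apply: IHk => i ltik; exact: (hs i.+1).
Qed.

Lemma recs_id n : recs (@id (ctx n)).
Proof. by apply: recsP => i; apply: rec_proj. Qed.

Lemma recs_weak n k (s : ctx n -> ctx k) : recs s -> recs (fun e : ctx n.+1 => s e.1).
Proof.
elim: k s => //= k IHk s [/IHk hs1 hs2]; split=> //.
exact: (rec_weak (f := fun e => (s e).2)).
Qed.

Lemma recs_skip n : recs (fun e : ctx n.+2 => (e.1.1, e.2) : ctx n.+1).
Proof.
split; last exact: rec_v0.
exact: (recs_weak (s := fun e : ctx n.+1 => e.1) (recs_weak (@recs_id n))).
Qed.

Lemma rec_app1 n (B : countType) (F : nat -> B) f :
  rec (fun e : ctx 1 => F e.2) -> rec f -> rec (fun e : ctx n => F (f e)).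
Proof.
move=> hF hf.
by apply: (rec_subst (f := fun e : ctx 1 => F e.2) (s := fun e => (tt, f e))) hF _.
Qed.

Lemma rec_app3 n (B : countType) (F : nat -> nat -> nat -> B) f g h :
  rec (fun e : ctx 3 => F e.1.1.2 e.1.2 e.2) -> rec f -> rec g -> rec h ->
  rec (fun e : ctx n => F (f e) (g e) (h e)).
Proof.
move=> hF *; apply: (rec_subst (f := fun e : ctx 3 => F e.1.1.2 e.1.2 e.2)
  (s := fun e => (tt, f e, g e, h e))) hF _ => //=.
Qed.

(** * Arithmetic, tests and bounded search *)

Lemma rec_succ n (f : ctx n -> nat) : rec f -> rec (fun e => (f e).+1).
Proof.
apply: (rec_app1 (F := succn)); exists MSucc => -[[] x] /=; constructor.
Qed.

Lemma rec_const_nat n (c : nat) : rec (fun _ : ctx n => c).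
Proof.
elim: c => [|c]; first by exists MZero => e; constructor.
exact: rec_succ.
Qed.

(** [MPrec] passes the counter first and the previous value second, so in the extended context the
    counter is [e.2] and the accumulator is [e.1.2]. *)
Lemma rec_iteri n (b f : ctx n -> nat) (G : ctx n -> nat -> nat -> nat) :
  rec b -> rec f -> rec (fun e : ctx n.+2 => G e.1.1 e.2 e.1.2) ->
  rec (fun e => iteri (b e) (G e) (f e)).
Proof.
move=> [pb hb] [pf hf] [pG hG].
exists (MComp (MPrec pf pG) (pb :: [seq MProj i | i <- iota 0 n])) => e.
have he := @mu_evals_proj 0 n (args e).
rewrite drop0 take_oversize ?size_args // in he.
apply: (@ev_comp _ _ _ (b e :: args e)).
  by constructor; [exact: hb | exact: he].
elim: (b e) => [|k IHk] /=; first by constructor.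
by apply: ev_precS IHk _; exact: (hG (e, iteri k (G e) (f e), k)).
Qed.

Lemma rec_add n (f g : ctx n -> nat) : rec f -> rec g -> rec (fun e => f e + g e).
Proof.
move=> hf hg; apply: (@eq_rec _ _ (fun e => iteri (f e) (fun=> succn) (g e))).
  by move=> e; elim: (f e) => //= k ->; rewrite addSn.
by apply: rec_iteri => //; apply/rec_succ/rec_v1.
Qed.

Lemma rec_mul n (f g : ctx n -> nat) : rec f -> rec g -> rec (fun e => f e * g e).
Proof.
move=> hf hg; apply: (@eq_rec _ _ (fun e => iteri (f e) (fun _ r => g e + r) 0)).
  by move=> e; elim: (f e) => //= k ->; rewrite mulSn.
apply: rec_iteri => //; first exact: rec_const_nat.
by apply: rec_add (rec_v1 _); exact: rec_weak2.
Qed.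

Lemma rec_exp n (f g : ctx n -> nat) : rec f -> rec g -> rec (fun e => f e ^ g e).
Proof.
move=> hf hg; apply: (@eq_rec _ _ (fun e => iteri (g e) (fun _ r => f e * r) 1)).
  by move=> e; elim: (g e) => //= k ->; rewrite expnS.
apply: rec_iteri => //; first exact: rec_const_nat.
by apply: rec_mul (rec_v1 _); exact: rec_weak2.
Qed.

Lemma rec_pred n (f : ctx n -> nat) : rec f -> rec (fun e => (f e).-1).
Proof.
move=> hf; apply: (@eq_rec _ _ (fun e => iteri (f e) (fun i _ => i) 0)).
  by move=> e; case: (f e).
apply: rec_iteri => //; [exact: rec_const_nat | exact: rec_v0].
Qed.

Lemma rec_sub n (f g : ctx n -> nat) : rec f -> rec g -> rec (fun e => f e - g e).
Proof.
move=> hf hg; apply: (@eq_rec _ _ (fun e => iteri (g e) (fun _ r => r.-1) (f e))).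
  by move=> e; elim: (g e) => [|k /= ->]; rewrite ?subn0 // subnS.
by apply: rec_iteri => //; apply/rec_pred/rec_v1.
Qed.

Lemma rec_eq0 n (f : ctx n -> nat) : rec f -> rec (fun e => f e == 0).
Proof.
move=> hf; apply: (@rec_unpickle _ bool).
apply: (@eq_rec _ _ (fun e => 1 - f e)); first by move=> e; case: (f e).
exact: rec_sub (rec_const_nat _ _) hf.
Qed.

Lemma rec_leq n (f g : ctx n -> nat) : rec f -> rec g -> rec (fun e => f e <= g e).
Proof. by move=> hf hg; apply/rec_eq0/rec_sub. Qed.

Lemma rec_ltn n (f g : ctx n -> nat) : rec f -> rec g -> rec (fun e => f e < g e).
Proof. by move=> hf hg; apply: rec_leq hg; apply: rec_succ. Qed.

Lemma rec_negb n (f : ctx n -> bool) : rec f -> rec (fun e => ~~ f e).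
Proof.
move=> /rec_pickle/rec_eq0; apply: eq_rec => e.
by case: (f e).
Qed.

Lemma rec_andb n (f g : ctx n -> bool) : rec f -> rec g -> rec (fun e => f e && g e).
Proof.
move=> hf hg; apply: (@rec_unpickle _ bool).
apply: (@eq_rec _ _ (fun e => (f e : nat) * (g e : nat))).
  by move=> e; case: (f e); case: (g e).
exact: rec_mul.
Qed.

(** A boolean is coded by 0 or 1, which is its value under the coercion. *)
Lemma rec_nat_of_bool n (f : ctx n -> bool) : rec f -> rec (fun e => f e : nat).
Proof. by []. Qed.

Lemma rec_eqn n (f g : ctx n -> nat) : rec f -> rec g -> rec (fun e => f e == g e).
Proof.
move=> hf hg; apply: (@eq_rec _ _ (fun e => (f e <= g e) && (g e <= f e))).
  by move=> e; rewrite eqn_leq.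
by apply: rec_andb; apply: rec_leq.
Qed.

Lemma rec_eq n (B : countType) (f g : ctx n -> B) :
  rec f -> rec g -> rec (fun e => f e == g e).
Proof.
move=> hf hg; apply: (@eq_rec _ _ (fun e => pickle (f e) == pickle (g e))).
  by move=> e; rewrite (inj_eq (pcan_inj pickleK)).
exact: rec_eqn.
Qed.

Lemma rec_if n (c : ctx n -> bool) (f g : ctx n -> nat) :
  rec c -> rec f -> rec g -> rec (fun e => if c e then f e else g e).
Proof.
move=> hc hf hg.
apply: (@eq_rec _ _ (fun e => (c e : nat) * f e + (~~ c e : nat) * g e)).
  by move=> e; case: (c e); rewrite /= ?mul1n ?mul0n ?addn0.
apply: rec_add; apply: rec_mul => //.
by apply/rec_nat_of_bool/rec_negb.
Qed.

Lemma rec_big n (idx : nat) (op : Monoid.law idx) (b : ctx n -> nat) F :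
  (forall m (f g : ctx m -> nat), rec f -> rec g -> rec (fun e => op (f e) (g e))) ->
  rec b -> rec (fun e : ctx n.+1 => F e.1 e.2) ->
  rec (fun e => \big[op/idx]_(0 <= i < b e) F e i).
Proof.
move=> hop hb hF.
apply: (@eq_rec _ _ (fun e => iteri (b e) (fun i r => op r (F e i)) idx)).
  move=> e; elim: (b e) => [|k /= ->]; first by rewrite big_geq.
  by rewrite big_nat_recr.
apply: rec_iteri => //; first exact: rec_const_nat.
apply: hop; first exact: rec_v1.
apply: (rec_subst (f := fun e : ctx n.+1 => F e.1 e.2)
  (s := fun e : ctx n.+2 => (e.1.1, e.2))) hF _.
exact: recs_skip.
Qed.

Lemma rec_sum n (b : ctx n -> nat) F :
  rec b -> rec (fun e : ctx n.+1 => F e.1 e.2) ->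
  rec (fun e => \sum_(0 <= i < b e) F e i).
Proof. exact/rec_big/rec_add. Qed.

Lemma rec_prod n (b : ctx n -> nat) F :
  rec b -> rec (fun e : ctx n.+1 => F e.1 e.2) ->
  rec (fun e => \prod_(0 <= i < b e) F e i).
Proof. exact/rec_big/rec_mul. Qed.

Lemma rec_max n (b : ctx n -> nat) F :
  rec b -> rec (fun e : ctx n.+1 => F e.1 e.2) ->
  rec (fun e => \max_(0 <= i < b e) F e i).
Proof.
apply: rec_big => m f g hf hg.
apply: (@eq_rec _ _ (fun e => f e + (g e - f e))) => [e|]; first by rewrite /= maxnE.
by apply: rec_add => //; apply: rec_sub.
Qed.

Lemma rec_has n (b : ctx n -> nat) (P : ctx n -> nat -> bool) :
  rec b -> rec (fun e : ctx n.+1 => P e.1 e.2) ->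
  rec (fun e => has (P e) (iota 0 (b e))).
Proof.
move=> hb hP; apply: (@eq_rec _ _ (fun e => 0 < \sum_(0 <= i < b e) P e i)).
  move=> e; rewrite lt0n sum_nat_seq_neq0 /index_iota subn0.
  by apply: eq_has => i /=; case: (P e i).
by apply: rec_ltn; [exact: rec_const_nat | apply: rec_sum; [|exact: rec_nat_of_bool]].
Qed.

Lemma rec_find n (b : ctx n -> nat) (P : ctx n -> nat -> bool) :
  rec b -> rec (fun e : ctx n.+1 => P e.1 e.2) ->
  rec (fun e => find (P e) (iota 0 (b e))).
Proof.
move=> hb hP.
(* The position of the first witness is the number of indices [i] with no witness among
   [0, ..., i]. *)
apply: (@eq_rec _ _
  (fun e => \sum_(0 <= i < b e) (~~ has (P e) (iota 0 i.+1) : nat))).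
  move=> e; elim: (b e) => [|k IHk]; first by rewrite big_geq.
  have -> : iota 0 k.+1 = iota 0 k ++ [:: k] by rewrite -addn1 iotaD.
  rewrite big_nat_recr // find_cat {}IHk size_iota.
  have -> : iota 0 k.+1 = iota 0 k ++ [:: k] by rewrite -addn1 iotaD.
  rewrite has_cat /= orbF.
  case: ifP => hk /=; first by rewrite addn0.
  move/negbT/hasNfind: hk => ->; rewrite size_iota.
  by case: (P e k).
apply: rec_sum => //; apply: rec_nat_of_bool; apply: rec_negb.
apply: (rec_has (b := fun e : ctx n.+1 => e.2.+1)); first exact/rec_succ/rec_v0.
apply: (rec_subst (f := fun e : ctx n.+1 => P e.1 e.2)
  (s := fun e : ctx n.+2 => (e.1.1, e.2))) hP _.
exact: recs_skip.
Qed.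

Lemma computable_rec (A B : countType) (h : A -> B) n (f : ctx n -> A) :
  computable h -> rec f -> rec (fun e => h (f e)).
Proof.
move=> [H [[p hp] hH]] [q hq]; exists (MComp p [:: q]) => e.
apply: (@ev_comp _ _ _ [:: pickle (f e)]); last by rewrite -hH.
by constructor; [exact: hq | constructor].
Qed.

Lemma rec_computable (B : countType) (F : nat -> B) :
  rec (fun e : ctx 1 => F e.2) -> computable F.
Proof. by move=> [p hp]; exists (pickle \o F); split=> //; exists p => n; exact: (hp (tt, n)). Qed.

Lemma rec_divn n (f g : ctx n -> nat) : rec f -> rec g -> rec (fun e => f e %/ g e).
Proof.
move=> hf hg.
(* The quotient is the least [i] with [f e < i.+1 * g e]; the last factor gives the default value 0
   for division by 0. *)
apply: (@eq_rec _ _ (fun e => find (fun i => f e < i.+1 * g e) (iota 0 (f e).+1) * (0 < g e))).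
  move=> e; case: (posnP (g e)) => [->|g0]; first by rewrite muln0 divn0.
  rewrite muln1; set P := fun i => _.
  have hasP : has P (iota 0 (f e).+1).
    apply/hasP; exists (f e %/ g e); last by rewrite /P -ltn_divLR.
    by rewrite mem_iota /= add0n ltnS leq_div.
  have lt_find : find P (iota 0 (f e).+1) < (f e).+1 by rewrite -{2}(size_iota 0 (f e).+1) -has_find.
  apply/eqP; rewrite eqn_leq; apply/andP; split.
    rewrite leqNgt; apply/negP => /(before_find 0).
    rewrite nth_iota ?add0n ?ltnS ?leq_div // /P => /negbT/negP; apply.
    by rewrite -ltn_divLR.
  have := nth_find 0 hasP; rewrite nth_iota // add0n /P.
  by rewrite -ltn_divLR // ltnS.
apply: rec_mul; last by apply/rec_nat_of_bool/rec_ltn => //; apply: rec_const_nat.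
apply: (rec_find (P := fun e i => f e < i.+1 * g e)); first exact: rec_succ.
apply: rec_ltn; first exact: rec_weak.
by apply: rec_mul; [exact/rec_succ/rec_v0 | exact: rec_weak].
Qed.

Lemma rec_modn n (f g : ctx n -> nat) : rec f -> rec g -> rec (fun e => f e %% g e).
Proof.
move=> hf hg; apply: (@eq_rec _ _ (fun e => f e - f e %/ g e * g e)).
  by move=> e; rewrite {1}(divn_eq (f e) (g e)) addKn.
by apply: rec_sub => //; apply: rec_mul => //; apply: rec_divn.
Qed.

Lemma rec_odd n (f : ctx n -> nat) : rec f -> rec (fun e => odd (f e)).
Proof.
move=> hf; apply: (@eq_rec _ _ (fun e => f e %% 2 == 1)).
  by move=> e; rewrite modn2; case: odd.
by apply: rec_eqn; [apply: rec_modn => // |]; apply: rec_const_nat.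
Qed.

(** * Codes of pairs and of binary strings *)

Lemma rec_code2 n (f g : ctx n -> nat) :
  rec f -> rec g -> rec (fun e => CodeSeq.code [:: f e; g e]).
Proof.
move=> hf hg.
apply: (@eq_rec _ _ (fun e => 2 ^ f e * (2 * (2 ^ g e) + 1))).
  by move=> e /=; rewrite double0 muln1 -mul2n addn1.
have h2 := rec_const_nat n 2.
by apply: rec_mul; [|apply: rec_add => //; [apply: rec_mul => //|exact: rec_const_nat]];
  apply: rec_exp.
Qed.

(* The string of the [n] lowest binary digits of [m], most significant first. *)
Fixpoint str (n m : nat) : seq bool :=
  if n is n'.+1 then rcons (str n' m./2) (odd m) else [::].

Lemma size_str n m : size (str n m) = n.
Proof. by elim: n m => //= n IHn m; rewrite size_rcons IHn. Qed.

Lemma str_cons n m : str n.+1 m = odd (m %/ 2 ^ n) :: str n m.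
Proof.
elim: n m => [|n IHn] m; first by rewrite /= expn0 divn1.
rewrite [LHS]/= -/(str n.+1 _) IHn [str n.+1 m]/= rcons_cons.
by rewrite expnS divnMA divn2.
Qed.

Lemma take_str n m i : i <= n -> take i (str n m) = str i (m %/ 2 ^ (n - i)).
Proof.
elim: n m => [|n IHn] m; first by rewrite leqn0 => /eqP ->.
rewrite leq_eqVlt => /predU1P[->|lt_in].
  by rewrite subnn expn0 divn1 take_oversize // size_str.
rewrite /= -cats1 takel_cat ?size_str // IHn // -divn2 -divnMA -expnS.
by rewrite subSn.
Qed.

Lemma str_surj (w : seq bool) : exists2 m, m < 2 ^ size w & str (size w) m = w.
Proof.
elim/last_ind: w => [|w b [m ltm hm]]; first by exists 0.
exists (b + m.*2); first by rewrite size_rcons expnS; case: b; lia.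
rewrite size_rcons /= half_bit_double hm oddD odd_double addbF.
by case: b.
Qed.

Lemma pickle_cons (b : bool) (s : seq bool) :
  pickle (b :: s) = 2 ^ b * (pickle s).*2.+1.
Proof. by []. Qed.

Lemma rec_str n (f g : ctx n -> nat) :
  rec f -> rec g -> rec (fun e => str (f e) (g e)).
Proof.
move=> hf hg; apply: rec_unpickle.
apply: (@eq_rec _ _ (fun e =>
  iteri (f e) (fun i r => 2 ^ (odd (g e %/ 2 ^ i)) * (2 * r + 1)) 0)).
  move=> e; elim: (f e) => // k IHk.
  by rewrite str_cons pickle_cons [LHS]/= IHk -mul2n addn1.
apply: rec_iteri => //; first exact: rec_const_nat.
have h2 := rec_const_nat n.+2 2.
apply: rec_mul; last first.
  by apply: rec_add; [apply: rec_mul => //; exact: rec_v1 | exact: rec_const_nat].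
apply: rec_exp => //; apply: rec_nat_of_bool; apply: rec_odd.
by apply: rec_divn; [exact: rec_weak2 | apply: rec_exp => //; exact: rec_v0].
Qed.

(** Length and value of a string are thus bounded by its code, which justifies the search bounds of
    [code_len] and [code_val]. *)
Lemma leq_pickle_str n m : 2 ^ n <= (pickle (str n m)).+1.
Proof.
elim: n => // n; rewrite str_cons pickle_cons expnS => IHn.
have := expn_gt0 2 (odd (m %/ 2 ^ n)); nia.
Qed.

Lemma find_iotaP (P : pred nat) b i : i < b -> P i -> P (find P (iota 0 b)).
Proof.
move=> ltib Pi; have hP : has P (iota 0 b).
  by apply/hasP; exists i => //; rewrite mem_iota.
have := hP; rewrite has_find size_iota => lt_find.
by have := nth_find 0 hP; rewrite nth_iota.
Qed.

Lemma hasP_iota (P : pred nat) b :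
  reflect (exists2 i, i < b & P i) (has P (iota 0 b)).
Proof.
apply: (iffP hasP) => -[i]; first by rewrite mem_iota => ? ?; exists i.
by move=> ? ?; exists i => //; rewrite mem_iota.
Qed.

(** The pair code underlying [pickle] is inverted by bounded search, so that computability of the
    inverse follows from [rec_find] and [rec_has]. *)
Definition code_fst x := find (fun a =>
  has (fun b => CodeSeq.code [:: a; b] == x) (iota 0 x.+1)) (iota 0 x.+1).
Definition code_snd x := find (fun b =>
  CodeSeq.code [:: code_fst x; b] == x) (iota 0 x.+1).

Lemma code_pairK a b : let x := CodeSeq.code [:: a; b] in
  code_fst x = a /\ code_snd x = b.
Proof.
move=> x; have /= /and3P[ltax ltbx _] : all (fun j => j < x) [:: a; b].
  exact: CodeSeq.ltn_code.
have e1 : code_fst x = a.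
  have /hasP_iota[b' _ /eqP] : has (fun b' => CodeSeq.code [:: code_fst x; b'] == x)
      (iota 0 x.+1).
    apply: (@find_iotaP (fun a => has (fun b => CodeSeq.code [:: a; b] == x) _) x.+1 a).
      exact: leqW.
    by apply/hasP_iota; exists b => //; exact: leqW.
  by move=> /(can_inj CodeSeq.codeK) [].
split => //; rewrite /code_snd e1.
have /eqP := @find_iotaP (fun b => CodeSeq.code [:: a; b] == x) x.+1 b (leqW ltbx) (eqxx _).
by move=> /(can_inj CodeSeq.codeK) [].
Qed.

Definition code_len x := find (fun n =>
  has (fun m => pickle (str n m) == x) (iota 0 x.+1)) (iota 0 x.+1).
Definition code_val x := find (fun m =>
  pickle (str (code_len x) m) == x) (iota 0 x.+1).

Lemma code_strK w : str (code_len (pickle w)) (code_val (pickle w)) = w.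
Proof.
have [m ltm hm] := str_surj w; set x := pickle w.
have hx : 2 ^ size w <= x.+1 by rewrite /x -hm size_str leq_pickle_str.
have ltm' : m < x.+1 by exact: leq_trans hx.
have /hasP_iota[m' ltm2 hm2] : has (fun m => pickle (str (code_len x) m) == x)
    (iota 0 x.+1).
  apply: (@find_iotaP (fun n => has (fun m => pickle (str n m) == x) _) x.+1 (size w)).
    by apply: leq_trans hx; rewrite ltn_expl.
  by apply/hasP_iota; exists m => //; rewrite hm.
have /eqP := @find_iotaP (fun m => pickle (str (code_len x) m) == x) x.+1 m' ltm2 hm2.
by rewrite -/(code_val x) => /(pcan_inj pickleK).
Qed.

Lemma rec_code_fst n (f : ctx n -> nat) : rec f -> rec (fun e => code_fst (f e)).
Proof.
apply: rec_app1; apply: (rec_find (b := fun e : ctx 1 => e.2.+1)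
  (P := fun e a => has (fun b => CodeSeq.code [:: a; b] == e.2) (iota 0 e.2.+1))).
  exact/rec_succ/rec_v0.
apply: (rec_has (b := fun e : ctx 2 => e.1.2.+1)
  (P := fun e b => CodeSeq.code [:: e.2; b] == e.1.2)); first exact/rec_succ/rec_v1.
by apply: rec_eqn (rec_v2 _); apply: rec_code2; [exact: rec_v1 | exact: rec_v0].
Qed.

Lemma rec_code_snd n (f : ctx n -> nat) : rec f -> rec (fun e => code_snd (f e)).
Proof.
apply: rec_app1; apply: (rec_find (b := fun e : ctx 1 => e.2.+1)
  (P := fun e b => CodeSeq.code [:: code_fst e.2; b] == e.2)).
  exact/rec_succ/rec_v0.
apply: rec_eqn (rec_v1 _); apply: rec_code2; last exact: rec_v0.
exact/rec_code_fst/rec_v1.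
Qed.

Lemma rec_code_len n (f : ctx n -> nat) : rec f -> rec (fun e => code_len (f e)).
Proof.
apply: rec_app1; apply: (rec_find (b := fun e : ctx 1 => e.2.+1)
  (P := fun e a => has (fun b => pickle (str a b) == e.2) (iota 0 e.2.+1))).
  exact/rec_succ/rec_v0.
apply: (rec_has (b := fun e : ctx 2 => e.1.2.+1)
  (P := fun e b => pickle (str e.2 b) == e.1.2)); first exact/rec_succ/rec_v1.
apply: rec_eqn (rec_v2 _); apply: rec_pickle.
by apply: rec_str; [exact: rec_v1 | exact: rec_v0].
Qed.

Lemma rec_code_val n (f : ctx n -> nat) : rec f -> rec (fun e => code_val (f e)).
Proof.
apply: rec_app1; apply: (rec_find (b := fun e : ctx 1 => e.2.+1)
  (P := fun e b => pickle (str (code_len e.2) b) == e.2)).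
  exact/rec_succ/rec_v0.
apply: rec_eqn (rec_v1 _); apply: rec_pickle; apply: rec_str; last exact: rec_v0.
exact/rec_code_len/rec_v1.
Qed.

(** Bridges the two notions: [computable] reads one code, while programs are written over the
    length, the digits and the stage. *)
Lemma rec_computable_strnat (B : countType) (F : seq bool * nat -> B) :
  rec (fun e : ctx 3 => F (str e.1.1.2 e.1.2, e.2)) -> computable F.
Proof.
move=> hF; pose G x :=
  F (str (code_len (code_fst x)) (code_val (code_fst x)), code_snd x).
have [h [hh hG]] : computable G.
  apply: rec_computable.
  apply: (rec_app3 (F := fun n m t => F (str n m, t))
    (f := fun e : ctx 1 => code_len (code_fst e.2))
    (g := fun e => code_val (code_fst e.2))) => //.
  - exact/rec_code_len/rec_code_fst/rec_v0.
  - exact/rec_code_val/rec_code_fst/rec_v0.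
  - exact/rec_code_snd/rec_v0.
exists h; split => // -[w t].
have [e1 e2] := code_pairK (pickle w) t.
have := hG (pickle (w, t)); rewrite /G.
rewrite -[pickle (w, t)]/(CodeSeq.code [:: pickle w; t]) e1 e2 code_strK.
by [].
Qed.

Lemma computable_strnat_rec (B : countType) (F : seq bool * nat -> B)
    n (f g h : ctx n -> nat) :
  computable F -> rec f -> rec g -> rec h ->
  rec (fun e => F (str (f e) (g e), h e)).
Proof.
move=> hF hf hg hh; apply: (computable_rec hF).
apply: (@rec_unpickle _ (seq bool * nat)%type).
apply: (rec_code2 (f := fun e => pickle (str (f e) (g e)))) => //.
exact/rec_pickle/rec_str.
Qed.

(** * Nonnegative rationals *)

Lemma rec_pickle_Posz n (f : ctx n -> nat) : rec f -> rec (fun e => pickle (Posz (f e))).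
Proof.
move=> hf; apply: (@eq_rec _ _ (fun e => CodeSeq.code [:: 2 ^ f e; 0])).
  by move=> e; rewrite -[2 ^ f e]muln1.
by apply: rec_code2; [apply: rec_exp => //|]; apply: rec_const_nat.
Qed.

Lemma rec_gcdn n (f g : ctx n -> nat) :
  (forall e, 0 < g e) -> rec f -> rec g -> rec (fun e => gcdn (f e) (g e)).
Proof.
move=> g0 hf hg.
(* Trying the divisors up to [g e] suffices because [g e] is positive. *)
apply: (@eq_rec _ _ (fun e => \max_(0 <= d < (g e).+1)
   (if (f e %% d == 0) && (g e %% d == 0) then d else 0))).
  move=> e; have gcd0 : 0 < gcdn (f e) (g e) by rewrite gcdn_gt0 g0 orbT.
  apply/eqP; rewrite eqn_leq; apply/andP; split.
    apply/bigmax_leqP_seq => d _ _; case: ifP => // /andP[df dg].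
    by apply: dvdn_leq => //; rewrite dvdn_gcd; apply/andP; split.
  rewrite big_mkord.
  have ltd : gcdn (f e) (g e) < (g e).+1.
    by rewrite ltnS; apply: dvdn_leq => //; apply: dvdn_gcdr.
  apply: (leq_trans _ (leq_bigmax (Ordinal ltd))) => /=.
  have := dvdn_gcdl (f e) (g e); have := dvdn_gcdr (f e) (g e).
  by rewrite /dvdn => -> ->.
apply: (rec_max (F := fun e d => if (f e %% d == 0) && (g e %% d == 0) then d else 0)).
  exact: rec_succ.
apply: rec_if; [|exact: rec_v0|exact: rec_const_nat].
by apply: rec_andb; apply: rec_eq0; (apply: rec_modn; [exact: rec_weak|exact: rec_v0]).
Qed.

(** The code of a rational consists of the codes of its numerator and denominator in lowest terms,
    so the fraction has to be reduced first. *)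
Lemma rec_frac n (f g : ctx n -> nat) : (forall e, 0 < g e) -> rec f -> rec g ->
  rec (fun e => (f e)%:R / (g e)%:R : rat)%R.
Proof.
move=> g0 hf hg; apply: rec_unpickle.
pose d e := gcdn (f e) (g e).
apply: (@eq_rec _ _ (fun e =>
  CodeSeq.code [:: pickle (Posz (f e %/ d e)); pickle (Posz (g e %/ d e))])).
  move=> e; have d0 : 0 < d e by rewrite gcdn_gt0 g0 orbT.
  have [k fE] := dvdnP (dvdn_gcdl (f e) (g e)).
  have [l gE] := dvdnP (dvdn_gcdr (f e) (g e)).
  rewrite -/(d e) in fE gE.
  have l0 : 0 < l by have := g0 e; rewrite gE; case: (l).
  have cop : coprime k l.
    rewrite /coprime -(eqn_pmul2r d0) mul1n muln_gcdl -fE -gE.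
    exact: eqxx.
  have -> : ((f e)%:R / (g e)%:R = (Posz k)%:~R / (Posz l)%:~R :> rat)%R.
    rewrite fE gE !natrM -mulf_div divff ?mulr1 //.
    by rewrite pnatr_eq0 -lt0n.
  set q := (_ / _)%R.
  rewrite -[pickle q]/(CodeSeq.code [:: pickle (numq q); pickle (denq q)]).
  rewrite /q coprimeq_num // coprimeq_den // {1}fE {1}gE !mulnK //.
  by rewrite eqz_nat eqn0Ngt l0 gtr0_sg ?mul1r // gtr0_norm.
have hd : rec d by apply: rec_gcdn.
by apply: rec_code2; apply: rec_pickle_Posz; apply: rec_divn.
Qed.
Local Open Scope ring_scope.

(** Arithmetic is done on unreduced fractions of natural numbers; the reduction that the code of a
    rational requires happens only once, in [ratrec_rec]. *)
Definition ratrec n (f : ctx n -> rat) := exists a b : ctx n -> nat,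
  [/\ rec a, rec b, (forall e, (0 < b e)%N) & forall e, f e = (a e)%:R / (b e)%:R].

Lemma ratrec_rec n (f : ctx n -> rat) : ratrec f -> rec f.
Proof.
move=> [a [b [ha hb b0 fE]]]; apply: (@eq_rec _ _ (fun e => (a e)%:R / (b e)%:R)).
  by move=> e; rewrite fE.
exact: rec_frac.
Qed.

Lemma ratrec_nat n (f : ctx n -> nat) : rec f -> ratrec (fun e => (f e)%:R).
Proof.
move=> hf; exists f, (fun=> 1%N); split => // [|e]; first exact: rec_const_nat.
by rewrite divr1.
Qed.

Lemma ratrec_mul n (f g : ctx n -> rat) :
  ratrec f -> ratrec g -> ratrec (fun e => f e * g e).
Proof.
move=> [a [b [ha hb b0 fE]]] [a' [b' [ha' hb' b0' gE]]].
exists (fun e => a e * a' e)%N, (fun e => b e * b' e)%N; split.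
- exact: rec_mul.
- exact: rec_mul.
- by move=> e; rewrite muln_gt0 b0 b0'.
- by move=> e; rewrite fE gE !natrM mulf_div.
Qed.

Lemma ratrec_exp n (f : ctx n -> rat) (k : ctx n -> nat) :
  ratrec f -> rec k -> ratrec (fun e => f e ^+ k e).
Proof.
move=> [a [b [ha hb b0 fE]]] hk.
exists (fun e => a e ^ k e)%N, (fun e => b e ^ k e)%N; split.
- exact: rec_exp.
- exact: rec_exp.
- by move=> e; rewrite expn_gt0 b0.
- by move=> e; rewrite fE expr_div_n !natrX.
Qed.

Lemma ratrec_const n (c : rat) : 0 <= c -> ratrec (fun _ : ctx n => c).
Proof.
move=> c0; exists (fun=> `|numq c|%N), (fun=> `|denq c|%N); split => [||e|e].
- exact: rec_const_nat.
- exact: rec_const_nat.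
- by rewrite absz_gt0 denq_neq0.
- by rewrite !natr_absz !ger0_norm ?numq_ge0 // divq_num_den.
Qed.

Lemma ratrec_sum n (b : ctx n -> nat) F :
  rec b -> ratrec (fun e : ctx n.+1 => F e.1 e.2) ->
  ratrec (fun e => \sum_(0 <= i < b e) F e i).
Proof.
move=> hb [p [q [hp hq q0 FE]]].
(* [Q e k] is a common denominator of the first [k] terms, and [P e k] the matching numerator. *)
pose Q (e : ctx n) k := (\prod_(0 <= i < k) q (e, i))%N.
pose P e k := iteri k (fun i r => r * q (e, i) + p (e, i) * Q e i)%N 0%N.
exists (fun e => P e (b e)), (fun e => Q e (b e)); split.
- rewrite /P; apply: (rec_iteri
    (G := fun e i r => (r * q (e, i) + p (e, i) * Q e i)%N)) => //.
    exact: rec_const_nat.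
  apply: rec_add; apply: rec_mul.
  + exact: rec_v1.
  + exact: (rec_subst hq (@recs_skip n)).
  + exact: (rec_subst hp (@recs_skip n)).
  + apply: (rec_prod (b := fun e : ctx n.+2 => e.2) (F := fun e i => q (e.1.1, i))).
      exact: rec_v0.
    apply: (rec_subst (s := fun e : ctx n.+3 => (e.1.1.1, e.2) : ctx n.+1) hq).
    split; last exact: rec_v0.
    exact: (recs_weak (s := fun e : ctx n.+2 => e.1.1) (recs_weak
             (s := fun e : ctx n.+1 => e.1) (recs_weak (@recs_id n)))).
- apply: (rec_prod (F := fun e i => q (e, i))) => //.
  by apply: eq_rec hq => -[].
- by move=> e; rewrite /Q prodn_cond_gt0.
- move=> e; have Q0 k : (Q e k)%:R != 0 :> rat.
    by rewrite pnatr_eq0 -lt0n /Q prodn_cond_gt0.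
  elim: (b e) => [|k IHk]; first by rewrite /P /= mul0r big_geq.
  rewrite big_nat_recr //= IHk (FE (e, k)) /P /= -/(P e k).
  rewrite addf_div ?Q0 // ?pnatr_eq0 -?lt0n ?q0 //.
  by rewrite natrD !natrM /Q big_nat_recr //= natrM.
Qed.

(** Only the code of [f e] is available, as for the approximations of a lower semicomputable
    function. Numerator and denominator do not exceed that code, so a bounded search recovers
    them. *)
Lemma rec_ltq n (a b : nat) (f : ctx n -> rat) : (0 < b)%N -> (forall e, 0 <= f e) ->
  rec f -> rec (fun e => a%:R / b%:R < f e).
Proof.
move=> b0 f0 hf.
apply: (@eq_rec _ _ (fun e => has (fun k => has (fun l =>
  (CodeSeq.code [:: pickle (Posz k); pickle (Posz l)] == pickle (f e)) &&
  (a * l < b * k)%N) (iota 0 (pickle (f e)).+1)) (iota 0 (pickle (f e)).+1))).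
  move=> e; set q := f e.
  have pickleE : pickle q = CodeSeq.code [:: pickle (numq q); pickle (denq q)] by [].
  have numE : numq q = `|numq q|%N by rewrite gez0_abs // numq_ge0 f0.
  have denE : denq q = `|denq q|%N by rewrite gez0_abs.
  have ltE : (a%:R / b%:R < q) = (a * `|denq q| < b * `|numq q|)%N.
    have qE : q = `|numq q|%:R / `|denq q|%:R.
      by rewrite !natr_absz !ger0_norm ?numq_ge0 ?f0 // divq_num_den.
    rewrite {1}qE.
    rewrite ltr_pdivrMr ?ltr0n // mulrAC ltr_pdivlMr; last first.
      by rewrite ltr0n absz_gt0 denq_neq0.
    by rewrite -!natrM ltr_nat [(_ * b)%N]mulnC.
  rewrite ltE; apply/hasP_iota/idP.
    move=> [k _ /hasP_iota[l _ /andP[/eqP]]].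
    rewrite pickleE => /(can_inj CodeSeq.codeK) [].
    by move=> /(pcan_inj pickleK) <- /(pcan_inj pickleK) <-.
  have lt_pickle (m : nat) : (m <= pickle (Posz m))%N.
    rewrite -[pickle _]/(CodeSeq.code [:: 2 ^ m * 1; 0])%N muln1.
    have /= /and3P[+ _ _] : all (fun j => j < CodeSeq.code [:: 2 ^ m; 0])%N [:: 2 ^ m; 0]%N.
      exact: CodeSeq.ltn_code.
    by move=> /ltnW; apply: leq_trans; apply/ltnW/ltn_expl.
  have [lt1 lt2] : (pickle (numq q) < pickle q /\ pickle (denq q) < pickle q)%N.
    rewrite pickleE; have := CodeSeq.ltn_code [:: pickle (numq q); pickle (denq q)].
    by move=> /allP h; split; apply: h; rewrite !inE eqxx ?orbT.
  move=> hlt; exists `|numq q|%N.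
    by rewrite ltnS; apply: leq_trans (ltnW lt1); rewrite {2}numE.
  apply: (introT (hasP_iota (fun l => (CodeSeq.code
    [:: pickle (Posz `|numq q|); pickle (Posz l)] == pickle q) &&
    (a * l < b * `|numq q|)%N) (pickle q).+1)); exists `|denq q|%N.
    by rewrite ltnS; apply: leq_trans (ltnW lt2); rewrite {2}denE.
  by rewrite hlt -numE -denE pickleE eqxx.
have hpf : rec (fun e => pickle (f e)) by [].
apply: (rec_has (b := fun e => (pickle (f e)).+1)) => /=; first exact: rec_succ.
apply: (rec_has (b := fun e : ctx n.+1 => (pickle (f e.1)).+1)
  (P := fun e l => (CodeSeq.code [:: pickle (Posz e.2); pickle (Posz l)] == pickle (f e.1))
    && (a * l < b * e.2)%N)); first exact: rec_succ (rec_weak hpf).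
apply: rec_andb.
  apply: rec_eqn; last exact: (rec_weak2 hpf).
  by apply: rec_code2; apply: rec_pickle_Posz; [exact: rec_v1 | exact: rec_v0].
apply: rec_ltn; apply: rec_mul;
  by [exact: rec_const_nat | exact: rec_v0 | exact: rec_v1].
Qed.

End Computability.

(** * Cylinders *)

Lemma big_nat_double (V : nmodType) (f : nat -> V) b :
  \sum_(0 <= m < b.*2) f m = \sum_(0 <= m < b) (f m.*2 + f m.*2.+1).
Proof.
elim: b => [|b IHb]; first by rewrite !big_geq.
by rewrite doubleS !big_nat_recr //= IHb addrA.
Qed.

Lemma sum_strS (V : nmodType) (f : seq bool -> V) n :
  \sum_(0 <= m < 2 ^ n.+1) f (str n.+1 m) =
  \sum_(0 <= m < 2 ^ n) (f (rcons (str n m) false) + f (rcons (str n m) true)).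
Proof.
rewrite expnS mul2n big_nat_double; apply: eq_bigr => m _ /=.
by rewrite doubleK odd_double uphalf_double.
Qed.

(** Refining the partition into cylinders of length [n] by one more bit preserves the total. *)
Lemma sum_str_additive (V : nmodType) (f : seq bool -> V) n :
  (forall w, f w = f (rcons w false) + f (rcons w true)) ->
  \sum_(0 <= m < 2 ^ n) f (str n m) = f [::].
Proof.
move=> fD; elim: n => [|n IHn]; first by rewrite expn0 big_nat1.
by rewrite sum_strS -IHn; apply: eq_bigr => m _; rewrite [RHS]fD.
Qed.

(* The uniform measure of the intersection of the cylinders of [v] and [w]. *)
Definition cyl_meet (F : numFieldType) (v w : seq bool) : F :=
  if take (minn (size v) (size w)) v == take (minn (size v) (size w)) w
  then 2^-1 ^+ maxn (size v) (size w) else 0.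

Section CylMeet.
Variable F : numFieldType.
Implicit Types v w : seq bool.

Lemma cyl_meet_ge0 v w : 0 <= cyl_meet F v w.
Proof. by rewrite /cyl_meet; case: ifP => // _; rewrite exprn_ge0 // invr_ge0. Qed.

Lemma cyl_meet0 v : cyl_meet F v [::] = 2^-1 ^+ size v.
Proof. by rewrite /cyl_meet /= minn0 maxn0 !take0 eqxx. Qed.

Lemma cyl_meet_le v w : cyl_meet F v w <= 2^-1 ^+ size v.
Proof.
rewrite /cyl_meet; case: ifP => _; last by rewrite exprn_ge0 // invr_ge0.
apply: ler_wiXn2l; rewrite ?invr_ge0 ?invf_le1 ?ler1n //.
exact: leq_maxl.
Qed.

Lemma cyl_meet_prefix v w : take (size v) w = v -> cyl_meet F v w = 2^-1 ^+ size w.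
Proof.
move=> vw; have le_vw : (size v <= size w)%N by rewrite -vw size_take_min geq_minr.
by rewrite /cyl_meet (minn_idPl le_vw) (maxn_idPr le_vw) vw take_size eqxx.
Qed.

(** If [v] is no longer than [w], both halves of [w] lie in the cylinder of [v] or both miss it;
    otherwise the next bit of [v] selects one half. *)
Lemma cyl_meetD v w :
  cyl_meet F v w = cyl_meet F v (rcons w false) + cyl_meet F v (rcons w true).
Proof.
rewrite /cyl_meet !size_rcons; have [le_vw|lt_wv] := leqP (size v) (size w).
  rewrite (minn_idPl (leqW le_vw)) (maxn_idPr (leqW le_vw)).
  rewrite (take_oversize (leqnn (size v))) -!cats1 !takel_cat //.
  case: ifP => _; last by rewrite addr0.
  by rewrite exprS; field.
rewrite (minn_idPr lt_wv) (maxn_idPl lt_wv).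
have takeW b : take (size w).+1 (rcons w b) = rcons w b.
  by rewrite take_oversize ?size_rcons.
rewrite !takeW take_size (take_nth false lt_wv) !eqseq_rcons.
by case: (take _ v == w); case: nth; rewrite /= ?addr0 ?add0r.
Qed.
End CylMeet.

(* Among the two halves of a cylinder that is covered too thinly, one is again
   covered too thinly; iterating yields a point that is not covered at all. *)
Lemma cyl_cover_ge (R : realType) (C : nat -> seq bool) (w : seq bool) :
  (forall Y, prefix Y (size w) = w -> exists k, prefix Y (size (C k)) = C k) ->
  ((2^-1 ^+ size w : R)%:E <= \sum_(0 <= k <oo) (cyl_meet R (C k) w)%:E)%E.
Proof.
move=> cover; pose M u := (\sum_(0 <= k <oo) (cyl_meet R (C k) u)%:E)%E.
have c0 u k : (0%N <= k)%N -> true -> (0 <= (cyl_meet R (C k) u)%:E)%E.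
  by move=> _ _; rewrite lee_fin cyl_meet_ge0.
have MD u : M u = (M (rcons u false) + M (rcons u true))%E.
  rewrite -nneseriesD => [|k _ _|k _ _]; do ?exact: c0.
  by apply: eq_eseriesr => k _; rewrite cyl_meetD EFinD.
rewrite leNgt -/(M w); apply/negP => thin_w.
pose thin u := (M u < (2^-1 ^+ size u)%:E)%E.
pose step u := if thin (rcons u false) then rcons u false else rcons u true.
have stepP u : thin u -> thin (step u).
  rewrite /step; case: ifPn => // + thin_u; rewrite /thin -leNgt size_rcons => h0.
  rewrite ltNge; apply/negP => h1; move: thin_u; apply/negP; rewrite /thin -leNgt.
  rewrite size_rcons in h1; rewrite MD; apply: le_trans (leeD h0 h1).
  by rewrite -EFinD lee_fin exprS; lra.
pose W k := iter k step w.
have thinW k : thin (W k) by elim: k => //= k; exact: stepP.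
have sizeW k : size (W k) = (size w + k)%N.
  elim: k => [|k IHk] /=; first by rewrite addn0.
  by rewrite /step; case: ifP => _; rewrite size_rcons IHk addnS.
pose Y i := nth false (W i.+1) i.
have nthW k i j : (i < size w + k)%N -> nth false (W (k + j)%N) i = nth false (W k) i.
  move=> lti; elim: j => [|j IHj]; first by rewrite addn0.
  rewrite addnS /= -IHj /step; have lti' : (i < size (W (k + j)))%N by rewrite sizeW; lia.
  by case: ifP => _; rewrite nth_rcons lti'.
have YW k : prefix Y (size w + k) = W k.
  apply: (@eq_from_nth _ false); first by rewrite size_mkseq sizeW.
  move=> i; rewrite size_mkseq => lti; rewrite nth_mkseq // /Y.
  have [le_ki|le_ik] := leqP k i.+1.
    by rewrite -(subnKC le_ki) nthW.
  by rewrite -(subnKC (ltnW le_ik)) nthW //; lia.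
have [|k Ck] := cover Y; first by rewrite -[size w]addn0 YW.
(* At depth [size (C k)] the string [W] extends [C k], so this single term of the series is already
   the full measure of a cylinder that should be thin. *)
have CW : take (size (C k)) (W (size (C k))) = C k.
  rewrite -YW /prefix -map_take take_iota.
  by rewrite (minn_idPl _) ?leq_addl.
have := thinW (size (C k)); apply/negP; rewrite /thin -leNgt.
rewrite -(cyl_meet_prefix R CW) /M (@nneseriesD1 _ _ k xpredT) //.
  by apply: leeDl; apply: nneseries_ge0 => j *; exact: c0.
by move=> j _; exact: c0.
Qed.

Lemma cantor_lambda_le (R : realType) (A : set (nat -> bool)) (C : nat -> seq bool)
    (V : pred nat) (K : R) :
  (forall Y, A Y -> exists2 j, V j & prefix Y (size (C j)) = C j) ->
  (forall n, \sum_(0 <= j < n | V j) 2^-1 ^+ size (C j) <= K) ->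
  (cantor_lambda R A <= K%:E)%E.
Proof.
move=> coverA sumK; apply/lee_addgt0Pr => eps eps0.
have [p hp] : exists p, 2^-1 ^+ p <= eps :> R.
  have h1 : `|2^-1 : R| < 1 by rewrite ger0_norm ?invr_ge0 // invf_lt1 // ltr1n.
  have /cvgrPdist_le /(_ eps eps0) [p _ /(_ p (leqnn p))] := cvg_geometric 1 h1.
  by rewrite sub0r normrN /= mul1r ger0_norm ?exprn_ge0 ?invr_ge0 //; exists p.
(* every index must name a cylinder, so the unused ones get cylinders of total
   measure [2^-p] *)
pose D j := if V j then C j else nseq (j + p).+1 false.
have sumD n : \sum_(0 <= j < n) 2^-1 ^+ size (D j) <=
    \sum_(0 <= j < n | V j) 2^-1 ^+ size (C j) + (2^-1 ^+ p - 2^-1 ^+ (n + p)) :> R.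
  elim: n => [|n IHn]; first by rewrite !big_geq // add0r subrr.
  rewrite big_nat_recr //= [X in _ <= X + _]big_mkcond big_nat_recr //= -big_mkcond /D.
  have : 0 <= 2^-1 ^+ (n + p) :> R by rewrite exprn_ge0 // invr_ge0.
  move: IHn; case: ifP => _; rewrite ?size_nseq ?addSn exprS; lra.
have leD : ((\sum_(0 <= j <oo) (2%:R ^- size (D j))%:E) <= (K + eps)%:E :> \bar R)%E.
  apply: lime_le; first by apply: is_cvg_nneseries => n _ _; rewrite lee_fin invr_ge0 exprn_ge0.
  apply: nearW => n; rewrite sumEFin lee_fin.
  under eq_bigr do rewrite -exprVn.
  apply: le_trans (sumD n) _.
  have : 0 <= 2^-1 ^+ (n + p) :> R by rewrite exprn_ge0 // invr_ge0.
  have := sumK n; lra.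
apply: le_trans leD; apply: ereal_inf_lbound; exists D => //.
by move=> Y /coverA [j Vj hj]; exists j; rewrite /D Vj.
Qed.

(** The total weight of a cover splits additively over the strings of length [n], and by
    [cyl_cover_ge] each string in [T] receives at least the measure of its own cylinder. *)
Lemma cantor_lambda_ge (R : realType) (A : set (nat -> bool)) (T : pred (seq bool)) n :
  (forall w, size w = n -> T w -> forall Y, prefix Y n = w -> A Y) ->
  (((\sum_(0 <= m < 2 ^ n) T (str n m))%N%:R * 2^-1 ^+ n : R)%:E <= cantor_lambda R A)%E.
Proof.
move=> TA; apply: le_ereal_inf_tmp => _ [C coverA <-].
pose M u := (\sum_(0 <= k <oo) (cyl_meet R (C k) u)%:E)%E.
have c0 u k : (0 <= (cyl_meet R (C k) u)%:E)%E by rewrite lee_fin cyl_meet_ge0.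
have MD u : M u = (M (rcons u false) + M (rcons u true))%E.
  rewrite -nneseriesD => [|k _ _|k _ _]; do ?exact: c0.
  by apply: eq_eseriesr => k _; rewrite cyl_meetD EFinD.
have -> : (\sum_(0 <= k <oo) (2%:R ^- size (C k))%:E = M [::] :> \bar R)%E.
  by apply: eq_eseriesr => k _; rewrite cyl_meet0 exprVn.
rewrite -(sum_str_additive n MD) natr_sum mulr_suml -sumEFin.
rewrite !big_mkord; apply: lee_sum => m _.
have M0 : (0 <= M (str n m))%E by apply: nneseries_ge0.
case Tw: (T (str n m)); rewrite ?mul0r // mul1r -{1}(size_str n m).
by apply: cyl_cover_ge => Y; rewrite size_str => /(TA _ (size_str n m) Tw) /coverA.
Qed.

(** * Upper limits and geometric sequences *)

Lemma limn_esup_gt (R : realType) (u : nat -> \bar R) c :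
  (c < limn_esup u)%E -> forall N, exists2 n, (N <= n)%N & (c < u n)%E.
Proof.
move=> ltc N; apply: contrapT => hn; move: ltc; apply/negP; rewrite -leNgt.
apply: (@le_trans _ _ (ereal_sup (u @` [set n | (N <= n)%N]))).
  by apply: ereal_inf_lbound; exists [set n | (N <= n)%N] => //; exists N.
apply: ge_ereal_sup => _ [n Nn <-]; rewrite leNgt; apply/negP => cn.
by apply: hn; exists n.
Qed.

Lemma limn_esup_ge (R : realType) (u : nat -> \bar R) c :
  (forall N, exists2 n, (N <= n)%N & (c <= u n)%E) -> (c <= limn_esup u)%E.
Proof.
move=> hc; apply: le_ereal_inf_tmp => _ [V [N _ NV] <-].
have [n Nn cn] := hc N; apply: le_trans cn _.
by apply: ereal_sup_ubound; exists n => //; apply: NV.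
Qed.

Lemma geometric_sum_le (F : realFieldType) (x : F) n : 0 <= x -> x < 1 ->
  \sum_(0 <= i < n) x ^+ i <= (1 - x)^-1.
Proof.
move=> x0 x1; have y0 : 0 < 1 - x by rewrite subr_gt0.
rewrite -[leRHS]mul1r ler_pdivlMr // mulrC big_mkord -opprB mulNr -subrX1.
by rewrite opprB lerBlDr lerDl exprn_ge0.
Qed.

Lemma expr_unbounded (R : realType) (A x : R) : 1 < x ->
  exists K, forall n, (K <= n)%N -> A <= x ^+ n.
Proof.
move=> x1; have x0 : 0 < x by lra.
have a0 : 0 < (`|A| + 1)^-1 by rewrite invr_gt0 ltr_wpDl.
have h1 : `|x^-1| < 1 by rewrite ger0_norm ?invr_ge0 ?invf_lt1 // ltW.
have /cvgrPdist_le /(_ _ a0) [K _ hK] := cvg_geometric 1 h1.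
exists K => n /hK; rewrite sub0r normrN /= mul1r exprVn.
rewrite ger0_norm ?invr_ge0 ?exprn_ge0 ?(ltW x0) //.
rewrite lef_pV2 ?posrE ?exprn_gt0 // ?ltr_wpDl //.
by have := ler_norm A; lra.
Qed.

Lemma eq_ratrec n (f g : ctx n -> rat) : f =1 g -> ratrec f -> ratrec g.
Proof.
by move=> fg [a [b [ha hb b0 fE]]]; exists a, b; split => // e; rewrite -fg.
Qed.

Lemma ratrec_cyl_meet n (a b c d : ctx n -> nat) :
  rec a -> rec b -> rec c -> rec d ->
  ratrec (fun e => cyl_meet rat (str (a e) (b e)) (str (c e) (d e))).
Proof.
move=> ha hb hc hd.
pose mn e := (a e - (a e - c e))%N; pose mx e := (a e + (c e - a e))%N.
apply: (@eq_ratrec _ (fun e =>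
  (str (mn e) (b e %/ 2 ^ (a e - mn e)) == str (mn e) (d e %/ 2 ^ (c e - mn e)) : nat)%:R
  * (2%:R^-1) ^+ mx e)).
  move=> e; rewrite /cyl_meet !size_str !take_str ?geq_minl ?geq_minr //.
  by rewrite minnE maxnE; case: eqP => _; rewrite ?mul1r ?mul0r.
have hmn : rec mn by apply: rec_sub => //; apply: rec_sub.
have hmx : rec mx by apply: rec_add => //; apply: rec_sub.
have h2 := rec_const_nat n 2.
apply: ratrec_mul.
  apply: ratrec_nat; apply: rec_nat_of_bool; apply: (@rec_eq _ (seq bool)).
    by apply: rec_str => //; apply: rec_divn => //; apply: rec_exp => //; apply: rec_sub.
  by apply: rec_str => //; apply: rec_divn => //; apply: rec_exp => //; apply: rec_sub.
by apply: ratrec_exp => //; apply: ratrec_const; rewrite invr_ge0.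
Qed.

(** * The gale of an enumerable set of strings *)

Section EnumerableGale.
Variables (P : seq bool * nat -> bool) (rho r : rat).
Hypothesis computableP : rec (fun e : ctx 3 => P (str e.1.1.2 e.1.2, e.2)).
Hypothesis monoP : forall v t, P (v, t) -> P (v, t.+1).
Hypotheses (rho0 : 0 < rho) (rho_lt_r : rho < r).

Let r0 : 0 < r. Proof. exact: lt_trans rho_lt_r. Qed.

Definition stage_weight (w : seq bool) (t n m : nat) : rat :=
  (P (str n m, t) : nat)%:R * ((2 / rho) ^+ n * cyl_meet rat (str n m) w).

(** Stage [t] looks only at strings of length at most [t], so the sum is finite and rational. *)
Definition stage_gale (w : seq bool) (t : nat) : rat :=
  r ^+ size w * \sum_(0 <= n < t.+1) \sum_(0 <= m < 2 ^ n) stage_weight w t n m.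

Lemma stage_weight_ge0 w t n m : 0 <= stage_weight w t n m.
Proof.
rewrite mulr_ge0 // mulr_ge0 ?cyl_meet_ge0 // exprn_ge0 // divr_ge0 //.
exact: ltW.
Qed.

Lemma stage_gale_ge0 w t : 0 <= stage_gale w t.
Proof.
rewrite mulr_ge0 ?exprn_ge0 ?(ltW r0) //.
by apply: sumr_ge0 => n _; apply: sumr_ge0 => m _; exact: stage_weight_ge0.
Qed.

Lemma stage_gale_mono w t : stage_gale w t <= stage_gale w t.+1.
Proof.
rewrite ler_pM2l ?exprn_gt0 // [leRHS]big_nat_recr //=.
apply: ler_wpDr.
  by apply: sumr_ge0 => m _; exact: stage_weight_ge0.
apply: ler_sum => n _; apply: ler_sum => m _; apply: ler_wpM2r.
  by rewrite mulr_ge0 ?cyl_meet_ge0 // exprn_ge0 // divr_ge0 // ltW.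
by rewrite ler_nat; case: (boolP (P _)) => // /monoP ->.
Qed.

(** The gale equation in base [r] holds exactly at every stage: the measures add up, and the extra
    bit contributes the factor [r]. *)
Lemma stage_galeD w t :
  stage_gale (rcons w false) t + stage_gale (rcons w true) t = r * stage_gale w t.
Proof.
rewrite /stage_gale !size_rcons exprS -mulrDr -mulrA; congr (_ * (_ * _)).
rewrite -big_split; apply: eq_bigr => n _; rewrite -big_split.
apply: eq_bigr => m _.
by rewrite /stage_weight (cyl_meetD _ _ w) !mulrDr.
Qed.

(** The term of [v] itself is [r ^ |v|] times [(2 / rho) ^ |v|] times [2 ^ - |v|]. *)
Lemma stage_gale_ge v t : P (v, t) -> (size v <= t)%N ->
  (r / rho) ^+ size v <= stage_gale v t.
Proof.
move=> Pv le_vt; have [m ltm vE] := str_surj v.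
have wE : stage_weight v t (size v) m = rho^-1 ^+ size v.
  rewrite /stage_weight vE Pv mul1r (cyl_meet_prefix _ (take_size v)) -exprMn.
  by congr (_ ^+ _); field; rewrite lt0r_neq0.
rewrite expr_div_n -exprVn ler_pM2l ?exprn_gt0 // -wE !big_mkord.
rewrite (bigD1 (Ordinal (le_vt : (size v < t.+1)%N))) //= big_mkord.
rewrite (bigD1 (Ordinal ltm)) //= -addrA lerDl addr_ge0 //.
  by apply: sumr_ge0 => i _; exact: stage_weight_ge0.
by apply: sumr_ge0 => i _; apply: sumr_ge0 => j _; exact: stage_weight_ge0.
Qed.

Lemma computable_stage_gale : computable (fun wt => stage_gale wt.1 wt.2).
Proof.
apply: rec_computable_strnat; apply: ratrec_rec.
apply: (@eq_ratrec _ (fun e : ctx 3 => r ^+ e.1.1.2 * \sum_(0 <= n < e.2.+1)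
   \sum_(0 <= m < 2 ^ n) stage_weight (str e.1.1.2 e.1.2) e.2 n m)).
  by move=> e; rewrite /stage_gale /= size_str.
apply: ratrec_mul; first by apply: ratrec_exp (rec_v2 _); apply/ratrec_const/ltW.
apply: (ratrec_sum (b := fun e : ctx 3 => e.2.+1) (F := fun e n => \sum_(0 <= m < 2 ^ n)
  stage_weight (str e.1.1.2 e.1.2) e.2 n m)); first exact/rec_succ/rec_v0.
apply: (ratrec_sum (b := fun e : ctx 4 => (2 ^ e.2)%N) (F := fun e m =>
  stage_weight (str e.1.1.1.2 e.1.1.2) e.1.2 e.2 m)).
  exact: rec_exp (rec_const_nat _ _) (rec_v0 _).
apply: ratrec_mul.
  apply: ratrec_nat; apply: rec_nat_of_bool.
  by apply: (rec_app3 (F := fun n m t => P (str n m, t)) computableP);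
    [exact: rec_v1 | exact: rec_v0 | exact: rec_v2].
apply: ratrec_mul.
  by apply: ratrec_exp (rec_v1 _); apply: ratrec_const; rewrite divr_ge0 // ltW.
apply: (ratrec_cyl_meet (n := 5)).
- exact: rec_v1.
- exact: rec_v0.
- exact: rec_v4.
- exact: rec_v3.
Qed.

Variables (R : realType) (B : R).
Hypotheses (B0 : 0 <= B) (B_lt_rho : B < ratr rho).
Hypothesis countP : forall n t, (\sum_(0 <= m < 2 ^ n) P (str n m, t))%N%:R <= B ^+ n.

(** There are at most [B ^ n] strings of length [n], each weighing at most [rho ^ - n], so the sum
    is dominated by a geometric series. The bound is uniform in [t], which makes the stages
    converge. *)
Lemma stage_gale_le w t :
  ratr (stage_gale w t) <= ratr r ^+ size w * (1 - B / ratr rho)^-1 :> R.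
Proof.
have rhoR : 0 < ratr rho :> R by rewrite ltr0q.
rewrite /stage_gale rmorphM rmorphXn /= ler_pM2l ?exprn_gt0 ?ltr0q //.
apply: le_trans (geometric_sum_le t.+1 _ _); last 2 first.
- by rewrite divr_ge0 // ltW.
- by rewrite ltr_pdivrMr // mul1r.
rewrite rmorph_sum /=; apply: ler_sum => n _.
rewrite expr_div_n ler_pdivlMr ?exprn_gt0 //.
apply: le_trans (countP n t); rewrite natr_sum rmorph_sum /= mulr_suml.
apply: ler_sum => m _; rewrite /stage_weight rmorphM /= ratr_nat -[leRHS]mulr1 -mulrA.
apply: ler_wpM2l => //.
have ratr1 : 1 = ratr 1 :> R by rewrite rmorph1.
rewrite -!rmorphXn -!rmorphM /= [leRHS]ratr1 ler_rat mulrAC -exprMn.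
rewrite divfK ?lt0r_neq0 //.
apply: le_trans (_ : 2 ^+ n * (2^-1) ^+ n <= _).
  by rewrite ler_pM2l ?exprn_gt0 // -{2}(size_str n m) cyl_meet_le.
by rewrite -exprMn divff // expr1n.
Qed.

Lemma enumerable_gale (s : R) : powR 2 s = ratr r ->
  exists d : seq bool -> R, [/\ is_gale s d, lower_semicomputable d &
    forall X, (forall N, exists2 n, (N <= n)%N & exists t, P (prefix X n, t)) ->
      gale_succeeds d X].
Proof.
move=> sE; pose u w t : R := ratr (stage_gale w t).
have und w : nondecreasing_seq (u w).
  by apply/nondecreasing_seqP => t; rewrite ler_rat stage_gale_mono.
have ucvg w : cvgn (u w).
  apply: nondecreasing_is_cvgn => //.
  by exists (ratr r ^+ size w * (1 - B / ratr rho)^-1) => _ [t _ <-]; exact: stage_gale_le.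
pose d w := limn (u w).
have ud w t : u w t <= d w by exact: nondecreasing_cvgn_le.
exists d; split.
- split=> [w|w].
    by apply: le_trans (ud w 0%N); rewrite ler0q stage_gale_ge0.
  have dD : d (rcons w false) + d (rcons w true) = ratr r * d w.
    (* The equation of the stages passes to the limit. *)
    apply: (@cvg_unique _ _ (u (rcons w false) \+ u (rcons w true) @ \oo)) => //.
      exact: cvgD.
    rewrite (_ : _ \+ _ = (fun t => ratr r * u w t)); last first.
      by apply/funext => t /=; rewrite /u -rmorphD /= stage_galeD rmorphM.
    exact: cvgMr.
  have powE n : powR 2 (- (s * n%:R)) = (ratr r ^+ n)^-1 :> R.
    by rewrite powRN powRrM sE powR_mulrn // ler0q ltW.
  have rn0 : ratr r != 0 :> R by rewrite fmorph_eq0 gt_eqF.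
  rewrite !powE -mulrDl dD exprS invfM.
  by field; rewrite ?expf_neq0 ?rn0.
- exists (fun wt => stage_gale wt.1 wt.2); split; first exact: computable_stage_gale.
  move=> w t; split => //=.
  + exact: stage_gale_ge0.
  + exact: stage_gale_mono.
  + exact: ud.
  + exact: ucvg.
- move=> X hX; apply/eqyP => A A0.
  have rr1 : 1 < ratr (r / rho) :> R by rewrite -(rmorph1 (@ratr R)) ltr_rat ltr_pdivlMr ?mul1r.
  apply: limn_esup_ge => N.
  have [K hK] := expr_unbounded A rr1.
  have [n] := hX (maxn N K); rewrite geq_max => /andP[Nn Kn] [t Pt].
  exists n => //; rewrite lee_fin; apply: le_trans (hK n Kn) _.
  (* The stage must be late enough both to enumerate the prefix and to admit its length. *)
  have Pt' : P (prefix X n, maxn t n).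
    elim: (maxn t n) (leq_maxl t n) => [|t' IH]; first by rewrite leqn0 => /eqP <-.
    by rewrite leq_eqVlt => /predU1P[<-//|/IH/monoP].
  apply: le_trans (ud _ (maxn t n)); rewrite /u -rmorphXn /= ler_rat.
  rewrite -{1}[n](size_mkseq X); apply: stage_gale_ge => //.
  by rewrite size_mkseq leq_maxr.
Qed.
End EnumerableGale.

(** * From learning functions to gales *)

Definition yes_count (l : learning_function) (w : seq bool) : nat :=
  (\sum_(0 <= i < (size w).+1) l (take i w))%N.

Lemma AVG_yes_count (R : realType) l w : AVG R l w = (yes_count l w)%:R / (size w)%:R.
Proof. by rewrite /AVG /yes_count natr_sum mulrC. Qed.

Lemma take_initial Y i n : (i <= n)%N -> take i (prefix Y n) = prefix Y i.
Proof. by move=> le_in; rewrite /prefix -map_take take_iota (minn_idPl le_in). Qed.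

Lemma size_initial Y n : size (prefix Y n) = n.
Proof. exact: size_mkseq. Qed.

Lemma yes_count_initial l Y n :
  yes_count l (prefix Y n) = size [seq i <- iota 0 n.+1 | l (prefix Y i)].
Proof.
rewrite size_filter -sum1_count /yes_count size_initial [RHS]big_mkcond /index_iota subn0.
apply: eq_big_seq => i; rewrite mem_iota add0n ltnS => /andP[_ le_in].
by rewrite take_initial //; case: (l _).
Qed.

(** Finitely many positions lie below their maximum, so one prefix already shows all these
    answers. *)
Lemma many_yesP l k Y :
  many_yes l k Y <-> exists n, (k <= yes_count l (prefix Y n))%N.
Proof.
split=> [[s [us ks /allP ls]]|[n kn]].
  exists (\max_(i <- s) i)%N; rewrite yes_count_initial; apply: leq_trans ks _.
  apply: uniq_leq_size => // i si; rewrite mem_filter (ls i si) mem_iota add0n ltnS.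
  exact: (leq_bigmax_seq (F := id)).
exists [seq i <- iota 0 n.+1 | l (prefix Y i)]; split.
- by rewrite filter_uniq // iota_uniq.
- by rewrite -yes_count_initial.
- exact: filter_all.
Qed.

(** With [q = a / b], an average above [q] at length [n] means at least [k = floor (q n) + 1] yes
    answers, on a whole cylinder. The measure of these cylinders is at most [2 ^ - k], which bounds
    their number. *)
Lemma count_AVG_gt (R : realType) (l : learning_function) (a b n : nat) :
  (0 < b)%N ->
  (forall k, (cantor_lambda R (many_yes l k) <= ((2%:R : R) ^- k)%:E)%E) ->
  (\sum_(0 <= m < 2 ^ n) ((a%:R / b%:R < AVG R l (str n m))%R : nat))%N%:R
    <= powR 2 (1 - a%:R / b%:R) ^+ n :> R.
Proof.
move=> b0 lamb; pose T w := a%:R / b%:R < AVG R l w; pose k := (a * n %/ b).+1.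
have b0R : 0 < b%:R :> R by rewrite ltr0n.
have Tmany w : size w = n -> T w -> forall Y, prefix Y n = w -> many_yes l k Y.
  move=> sw Tw Y Yw; apply/many_yesP; exists n; rewrite Yw /k.
  move: Tw; rewrite /T AVG_yes_count sw.
  (* For the empty string the average is 0 by the convention on division, so it cannot exceed
     [a / b]. *)
  case: n sw Yw @k => [|n] sw Yw k; first by rewrite invr0 mulr0 ltNge divr_ge0.
  rewrite ltr_pdivrMr // mulrAC ltr_pdivlMr ?ltr0n // -!natrM ltr_nat.
  by rewrite ltn_divLR // mulnC.
have := le_trans (cantor_lambda_ge R Tmany) (lamb k); rewrite lee_fin -exprVn.
set S := _%:R => hS.
have {}hS : S <= 2 ^+ n * 2^-1 ^+ k.
  by rewrite -ler_pdivrMl ?exprn_gt0 // -exprVn mulrC.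
apply: le_trans hS _.
have two0 : 2 != 0 :> R by [].
rewrite -powR_mulrn ?powR_ge0 // -powRrM -[2 ^+ n]powR_mulrn // exprVn.
rewrite -[2 ^+ k]powR_mulrn // -powRN -powRD ?two0 ?implybT //.
apply: ler_powR; first by rewrite ler1n.
rewrite mulrBl mul1r lerB // mulrAC ler_pdivrMr // -!natrM ler_nat /k.
by apply: ltnW; rewrite -ltn_divLR.
Qed.

Lemma powR2_log2 (R : realType) (x : R) : 0 < x -> powR 2 (ln x / ln 2) = x.
Proof.
move=> x0; have ln2 : ln 2 != 0 :> R by rewrite gt_eqF // ln_gt0 // ltr1n.
by rewrite /powR (gt_eqF (ltr0Sn R 1)) divfK // lnK.
Qed.

Lemma rat_between (R : realType) (x y : R) : x < y -> exists q : rat, x < ratr q < y.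
Proof. by move=> xy; have [q] := rat_in_itvoo xy; rewrite in_itv /=; exists q. Qed.

Lemma G_constr_dim_set (R : realType) (Gamma : set (nat -> bool)) (s s' : R) :
  G_constr Gamma s -> s < s' -> exists2 s1, dim_set Gamma s1 & s1 <= s'.
Proof.
move=> [s0 [l hl]] lt_ss'.
have two1 : 1 < 2 :> R by rewrite ltr1n.
have lt_pow (x y : R) : x < y -> powR 2 x < powR 2 y.
  move=> xy; rewrite /powR (gt_eqF (ltr0Sn R 1)) ltr_expR ltr_pM2r //.
  exact: ln_gt0.
(* In [2 ^ s < rho < r < 2 ^ s'] the gap below [rho] makes the gale converge, the gap above makes it
   succeed, and [log2 r] stays below [s']. *)
have [r /andP[lt_sr lt_rs']] := rat_between (lt_pow _ _ lt_ss').
have [rho /andP[lt_srho lt_rhor]] := rat_between lt_sr.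
have pows1 : 1 <= powR 2 s by have := ler_powR (ltW two1) s0; rewrite powRr0.
have r1 : 1 < ratr r :> R by apply: le_lt_trans pows1 _.
have r0 : 0 < ratr r :> R by apply: lt_trans r1.
have rho0 : 0 < ratr rho :> R by apply: lt_trans lt_srho; rewrite powR_gt0.
exists (ln (ratr r) / ln 2); last first.
  rewrite leNgt; apply/negP => /lt_pow; rewrite powR2_log2 //.
  by move=> /(lt_trans lt_rs'); rewrite ltxx.
split; first by rewrite divr_ge0 // ltW // ln_gt0.
suff [P [B [hP mono [B0 B_rho] count freq]]] : exists P : seq bool * nat -> bool,
    exists B : R, [/\ rec (fun e : ctx 3 => P (str e.1.1.2 e.1.2, e.2)),
    forall v t, P (v, t) -> P (v, t.+1), 0 <= B /\ B < ratr rho,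
    forall n t, (\sum_(0 <= m < 2 ^ n) P (str n m, t))%N%:R <= B ^+ n &
    forall X, Gamma X -> forall N, exists2 n, (N <= n)%N & exists t, P (prefix X n, t)].
  have rho0' : 0 < rho by rewrite -(ltr0q R).
  have lt_rhor' : rho < r by rewrite -(ltr_rat R).
  have [d [gd ld sd]] := enumerable_gale hP mono rho0' lt_rhor' B0 B_rho count (powR2_log2 r0).
  by exists d; split => // X /freq; exact: sd.
(* The properties of [l] are available only through a member of [Gamma]; for empty [Gamma] the empty
   enumeration serves. *)
have [[X0 GX0]|noX] := pselect (exists X, Gamma X); last first.
  exists (fun=> false), (powR 2 s); split => //.
  - exact: rec_const_nat.
  - by move=> n t; rewrite big1 // exprn_ge0 // powR_ge0.
  - by move=> X GX; case: noX; exists X.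
(* If [s >= 1], all strings may be enumerated, since [2 ^ n <= (2 ^ s) ^ n]. *)
have [le1s|lt_s1] := leP 1 s.
  exists (fun=> true), (powR 2 s); split => //.
  - exact: (rec_const_nat 3 1).
  - move=> n t; rewrite sum_nat_const_nat subn0 muln1 natrX.
    apply: lerXn2r; rewrite ?nnegrE ?powR_ge0 //.
    by have := ler_powR (ltW two1) le1s; rewrite powRr1.
  - by move=> X _ N; exists N => //; exists 0%N.
have [[g [cg gP]] lamb _] := hl _ GX0.
pose sigma := ln (ratr rho) / ln 2 : R.
have sigmaE : powR 2 sigma = ratr rho by exact: powR2_log2.
have lt_s_sigma : s < sigma.
  rewrite ltNge; apply/negP => /(ler_powR (ltW two1)); rewrite sigmaE.
  by rewrite leNgt lt_srho.
(* [q < 1 - s] puts [q] below the upper limit of the averages, [q > 1 - sigma] gives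
   [2 ^ (1 - q) < rho], and positivity allows natural [a] and [b]. *)
have [q /andP[+ lt_q]] : exists q : rat, Num.max 0 (1 - sigma) < ratr q < 1 - s.
  by apply: rat_between; rewrite gt_max subr_gt0 lt_s1 ltrD2l ltrN2.
rewrite gt_max => /andP[q0 sigma_q].
pose a := `|numq q|%N; pose b := `|denq q|%N.
have b0 : (0 < b)%N by rewrite absz_gt0 denq_neq0.
have qE : q = a%:R / b%:R.
  by rewrite /a /b !natr_absz !ger0_norm ?numq_ge0 ?divq_num_den // -(ler0q R) ltW.
have qER : ratr q = a%:R / b%:R :> R by rewrite qE rmorphM fmorphV /= !ratr_nat.
exists (fun wt => a%:R / b%:R < g wt), (powR 2 (1 - ratr q)); split.
- apply: rec_ltq => // [e|]; first by have [] := gP (str e.1.1.2 e.1.2) e.2.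
  by apply: (computable_strnat_rec (n := 3)) => //; [exact: rec_v2|exact: rec_v1|exact: rec_v0].
- by move=> v t /lt_le_trans; apply; have [] := gP v t.
- rewrite powR_ge0 -sigmaE; split => //; apply: lt_pow; lra.
- move=> n t; rewrite qER; apply: le_trans (count_AVG_gt a n b0 lamb).
  rewrite ler_nat; apply: leq_sum => m _; case: (ltP (_ / _) (g _)) => //= ltg.
  rewrite -qER lt0b; apply: lt_le_trans (_ : ratr (g (str n m, t)) <= _).
    by rewrite ltr_rat qE.
  by have [] := gP (str n m) t.
- move=> X GX N; have [_ _ hX] := hl _ GX.
  have lt_esup : ((ratr q)%:E < limn_esup (fun n => (AVG R l (prefix X n))%:E))%E.
    by apply: lt_le_trans hX; rewrite lte_fin.
  have [n Nn] := limn_esup_gt lt_esup N; rewrite lte_fin => ltq.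
  exists n => //; have [_ _ _ cvgg] := gP (prefix X n) 0%N.
  (* A strict inequality for the limit is witnessed at a finite stage. *)
  have /cvgrPdist_lt /(_ _ (_ : 0 < AVG R l (prefix X n) - ratr q)) := cvgg.
  rewrite subr_gt0 => /(_ ltq) [t _ /(_ t (leqnn t))] /= dist.
  exists t; rewrite -qE -(ltr_rat R).
  by move: dist => /ltr_normlP [_]; lra.
Qed.

(** * The learning function of an enumerable set of strings *)

Lemma leq_bigmax_natP (F : nat -> nat) b j : (0 < j)%N ->
  ((j <= \max_(0 <= i < b) F i)%N <-> exists2 i, (i < b)%N & (j <= F i)%N).
Proof.
move=> j0; rewrite big_mkord; split=> [jmax|[i ltib jF]]; last first.
  exact: leq_trans jF (leq_bigmax (Ordinal ltib)).
case: b jmax => [|b]; first by rewrite big_ord0 leqNgt j0.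
have [|i ->] := @bigop.eq_bigmax _ (fun i : 'I_b.+1 => F i); first by rewrite card_ord.
by exists i.
Qed.

Lemma leq_of_pos (a b : nat) : (forall j, (0 < j)%N -> (j <= a)%N -> (j <= b)%N) -> (a <= b)%N.
Proof. by case: a => // a; apply. Qed.

(** With the next two lemmas this lists all strings by one index: a positive integer [2 ^ n + m]
    with [m < 2 ^ n] stands for [str n m]. *)
Lemma str_addX n m : str n (2 ^ n + m) = str n m.
Proof.
elim: n m => //= n IHn m; rewrite expnS mul2n halfD odd_double /= add0n doubleK IHn.
by rewrite oddD odd_double.
Qed.

Lemma trunc_log2_addX n m : (m < 2 ^ n)%N -> trunc_log 2 (2 ^ n + m) = n.
Proof. by move=> ltm; apply: trunc_log_eq => //; rewrite leq_addr expnS; lia. Qed.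

Lemma sum_dyadic_blocks (V : nmodType) (F : nat -> V) J :
  \sum_(0 <= i < (2 ^ J).-1) F i.+1 =
  \sum_(0 <= n < J) \sum_(0 <= m < 2 ^ n) F (2 ^ n + m)%N.
Proof.
elim: J => [|J IHJ]; first by rewrite !big_geq.
rewrite big_nat_recr //= -IHJ (@big_cat_nat _ _ _ (2 ^ J).-1) //=; last first.
  by rewrite expnS; lia.
congr (_ + _); rewrite -{1}[(2 ^ J).-1]add0n big_addn.
have -> : ((2 ^ J.+1).-1 - (2 ^ J).-1 = 2 ^ J)%N.
  by rewrite expnS; have := expn_gt0 2 J; lia.
apply: eq_bigr => m _; congr F.
by have := expn_gt0 2 J; lia.
Qed.

Section EnumerableLearner.
Variables (P : seq bool * nat -> bool) (k : nat -> nat).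
Hypothesis computableP : rec (fun e : ctx 3 => P (str e.1.1.2 e.1.2, e.2)).
Hypothesis computable_k : rec (fun e : ctx 1 => k e.2).
Hypothesis monoP : forall v t, P (v, t) -> P (v, t.+1).
Hypothesis k_le : forall n, (k n <= n)%N.

Let P_leq v t t' : (t <= t')%N -> P (v, t) -> P (v, t').
Proof.
elim: t' => [|t' IH]; first by rewrite leqn0 => /eqP ->.
by rewrite leq_eqVlt => /predU1P[->//|/IH h /h /monoP].
Qed.

(* Aiming at [k |v|] answers yes along an enumerated string [v], the learner says
   yes exactly at the last [k |v|] prefixes of [v]; at its prefix of length [i]
   this makes [k |v| - (|v| - i)] answers. *)
Definition yes_at (j : nat) (w v : seq bool) : Prop :=
  exists2 i, (i <= minn (size v) (size w))%N &
    take i v = take i w /\ (j + size v <= k (size v) + i)%N.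

(** The truncated difference [k n + i - n] is 0 until [i] enters the last [k n] positions; this is
    why the characterisations below concern positive [j]. *)
Definition stage_count (w : seq bool) (t : nat) : nat :=
  \max_(0 <= i < (size w).+1) \max_(0 <= n < t.+1) \max_(0 <= m < 2 ^ n)
    (if [&& (i <= n)%N, take i (str n m) == take i w & P (str n m, t)]
     then k n + i - n else 0)%N.

Lemma leq_stage_countP j w t : (0 < j)%N ->
  (j <= stage_count w t)%N <->
  exists v, [/\ (size v <= t)%N, P (v, t) & yes_at j w v].
Proof.
move=> j0; split.
  move=> /(leq_bigmax_natP _ _ j0) [i lti] /(leq_bigmax_natP _ _ j0) [n ltn].
  move=> /(leq_bigmax_natP _ _ j0) [m ltm]; case: ifP => [|_]; last by rewrite leqNgt j0.
  move=> /and3P[le_in /eqP takeE Pv] le_j; exists (str n m); rewrite size_str; split=> //.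
  exists i; first by rewrite size_str leq_min le_in.
  by rewrite size_str; split=> //; lia.
move=> [v [le_vt Pv [i]]]; rewrite leq_min => /andP[le_iv le_iw] [takeE le_j].
have [m ltm vE] := str_surj v.
apply/(leq_bigmax_natP _ _ j0); exists i => //.
apply/(leq_bigmax_natP _ _ j0); exists (size v) => //.
apply/(leq_bigmax_natP _ _ j0); exists m => //.
by rewrite vE le_iv takeE eqxx Pv /=; lia.
Qed.

Lemma stage_count_mono w t : (stage_count w t <= stage_count w t.+1)%N.
Proof.
apply: leq_of_pos => j j0 /leq_stage_countP-/(_ j0) [v [le_vt Pv yv]].
by apply/leq_stage_countP => //; exists v; split=> //; [exact: leqW | exact: monoP].
Qed.

Lemma stage_count_le w t : (stage_count w t <= size w)%N.
Proof.
apply: leq_of_pos => j j0 /leq_stage_countP-/(_ j0) [v [_ _ [i]]].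
by rewrite leq_min => /andP[_ le_iw] [_]; have := k_le (size v); lia.
Qed.

Lemma rec_stage_count :
  rec (fun e : ctx 3 => stage_count (str e.1.1.2 e.1.2) e.2).
Proof.
pose F (a b t i n m : nat) := (if [&& (i <= n)%N,
  str i (m %/ 2 ^ (n - i)) == str i (b %/ 2 ^ (a - i)) & P (str n m, t)]
  then k n + i - n else 0)%N.
apply: (@eq_rec _ _ (fun e : ctx 3 => \max_(0 <= i < e.1.1.2.+1)
  \max_(0 <= n < e.2.+1) \max_(0 <= m < 2 ^ n) F e.1.1.2 e.1.2 e.2 i n m)%N).
  move=> e; rewrite /stage_count size_str; apply: eq_big_nat => i /andP[_ lti].
  apply: eq_bigr => n _; apply: eq_bigr => m _; rewrite /F.
  by case: leqP => //= le_in; rewrite !take_str.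
apply: (rec_max (b := fun e : ctx 3 => e.1.1.2.+1) (F := fun e i =>
  \max_(0 <= n < e.2.+1) \max_(0 <= m < 2 ^ n) F e.1.1.2 e.1.2 e.2 i n m)).
  exact/rec_succ/rec_v2.
apply: (rec_max (b := fun e : ctx 4 => e.1.2.+1) (F := fun e n =>
  \max_(0 <= m < 2 ^ n) F e.1.1.1.2 e.1.1.2 e.1.2 e.2 n m)).
  exact/rec_succ/rec_v1.
apply: (rec_max (b := fun e : ctx 5 => (2 ^ e.2)%N) (F := fun e m =>
  F e.1.1.1.1.2 e.1.1.1.2 e.1.1.2 e.1.2 e.2 m)).
  exact: rec_exp (rec_const_nat _ _) (rec_v0 _).
have [v0 v1] := (rec_v0 5, rec_v1 4); have [v2 v3] := (rec_v2 3, rec_v3 2).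
have [v4 v5] := (rec_v4 1, rec_v5 0).
have two := rec_const_nat 6 2.
rewrite /F; apply: (rec_if (n := 6)).
- apply: (rec_andb (n := 6)); first exact: rec_leq.
  apply: (rec_andb (n := 6)).
    apply: (@rec_eq 6 (seq bool)); apply: rec_str => //; apply: rec_divn => //.
      by apply: rec_exp => //; apply: rec_sub.
    by apply: rec_exp => //; apply: rec_sub.
  exact: (rec_app3 (F := fun n m t => P (str n m, t)) computableP).
- by apply: rec_sub => //; apply: rec_add => //; apply: (rec_app1 computable_k).
- exact: rec_const_nat.
Qed.

Definition enumerated (v : seq bool) : bool := `[< exists t, P (v, t) >].

(** [stage_count w] is nondecreasing and bounded by [size w], hence eventually constant; the limit
    is chosen without effectivity. *)
Lemma yes_limit_exists : exists N : seq bool -> nat, forall w,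
  (forall t, (stage_count w t <= N w)%N) /\
  exists t0, forall t, (t0 <= t)%N -> stage_count w t = N w.
Proof.
suff /choice [N hN] : forall w, exists L, (forall t, (stage_count w t <= L)%N) /\
  exists t0, forall t, (t0 <= t)%N -> stage_count w t = L by exists N.
move=> w.
pose Q j := `[< exists t, stage_count w t = j >].
have exQ : exists j, Q j by exists (stage_count w 0%N); apply/asboolP; exists 0%N.
have ubQ j : Q j -> (j <= size w)%N by move=> /asboolP [t <-]; exact: stage_count_le.
case: (ex_maxnP exQ ubQ) => L /asboolP [t0 t0L] maxL.
have leL t : (stage_count w t <= L)%N by apply: maxL; apply/asboolP; exists t.
exists L; split=> //; exists t0 => t le_t; apply/eqP; rewrite eqn_leq leL -t0L.
by apply: (homo_leq (leqnn) leq_trans) le_t => i; exact: stage_count_mono.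
Qed.

Variables (R : realType) (N : seq bool -> nat).
Hypothesis N_limit : forall w, (forall t, (stage_count w t <= N w)%N) /\
  exists t0, forall t, (t0 <= t)%N -> stage_count w t = N w.

Lemma leq_limitP j w : (0 < j)%N ->
  (j <= N w)%N <-> exists2 v, enumerated v & yes_at j w v.
Proof.
move=> j0; have [leN [t0 eqN]] := N_limit w; split=> [|[v /asboolP [t Pv] yv]].
  rewrite -(eqN t0) // => /leq_stage_countP-/(_ j0) [v [_ Pv yv]].
  by exists v => //; apply/asboolP; exists t0.
apply: leq_trans (leN (maxn t (size v))); apply/leq_stage_countP => //.
by exists v; split=> //; [exact: leq_maxr | exact: P_leq (leq_maxl _ _) Pv].
Qed.

(** A yes marks an increase of [N] caused by the last bit, so the answers telescope to [N]. At the
    empty string [take] changes nothing and the answer is no. *)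
Definition learner (w : seq bool) : bool := (N (take (size w).-1 w) < N w)%N.

Lemma limit_nil : N [::] = 0%N.
Proof.
apply/eqP; rewrite -leqn0; apply: leq_of_pos => j j0.
move=> /(leq_limitP _ j0) [v _ [i]]; rewrite minn0 leqn0 => /eqP -> [_].
by have := k_le (size v); lia.
Qed.

(** Shortening the common prefix with [v] by one bit costs one answer, so [N] rises by at most one
    per bit. *)
Lemma limit_rcons w b : (N w <= N (rcons w b) <= (N w).+1)%N.
Proof.
apply/andP; split; apply: leq_of_pos => j j0.
  move=> /(leq_limitP _ j0) [v Av [i]]; rewrite leq_min => /andP[iv iw] [tE hj].
  apply/(leq_limitP _ j0); exists v => //; exists i.
    by rewrite leq_min iv size_rcons leqW.
  by rewrite -cats1 takel_cat.
move=> /(leq_limitP _ j0) [v Av [i]]; rewrite leq_min size_rcons => /andP[iv iw] [tE hj].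
case: j j0 hj => // j _ hj; rewrite ltnS; case: (posnP j) => [->//|j0].
apply/(leq_limitP _ j0); exists v => //; exists i.-1.
  by rewrite leq_min; lia.
split; last by lia.
have lei : (i.-1 <= i)%N by lia.
have leiw : (i.-1 <= size w)%N by lia.
by rewrite -(take_takel v lei) tE take_takel // -cats1 takel_cat.
Qed.

Lemma yes_count_learner w : yes_count learner w = N w.
Proof.
elim/last_ind: w => [|w b IHw].
  by rewrite /yes_count big_nat1 /learner /= ltnn limit_nil.
rewrite /yes_count size_rcons big_nat_recr //=.
have -> : (\sum_(0 <= i < (size w).+1) learner (take i (rcons w b)) = N w)%N.
  rewrite -IHw; apply: eq_big_nat => i /andP[_ lti].
  by rewrite -cats1 takel_cat.
rewrite take_oversize ?size_rcons // /learner size_rcons /= -cats1 take_size_cat //.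
by have := limit_rcons w b; rewrite cats1; lia.
Qed.

Lemma yes_count_enumerated v : enumerated v -> (k (size v) <= yes_count learner v)%N.
Proof.
move=> Av; rewrite yes_count_learner; case: (posnP (k (size v))) => [->//|k0].
by apply/leq_limitP => //; exists v => //; exists (size v); rewrite ?minnn.
Qed.

Lemma lower_semicomputable_learner : lower_semicomputable (@AVG R learner).
Proof.
exists (fun wt => (stage_count wt.1 wt.2)%:R / (size wt.1)%:R); split.
  (* The denominator is raised to 1 at the empty string, where the count is 0, so the quotient
     agrees with division by 0. *)
  apply: rec_computable_strnat; apply: (@eq_rec _ _ (fun e : ctx 3 =>
    (stage_count (str e.1.1.2 e.1.2) e.2)%:R / (e.1.1.2 + (e.1.1.2 == 0))%N%:R : rat)).
    move=> e /=; rewrite size_str; case: e.1.1.2 => [|n]; last by rewrite addn0.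
    have /eqP -> : stage_count (str 0 e.1.2) e.2 == 0%N by rewrite -leqn0 stage_count_le.
    by rewrite !mul0r.
  apply: rec_frac => [e||]; first by case: e.1.1.2.
    exact: rec_stage_count.
  apply: rec_add; first exact: rec_v2.
  exact/rec_nat_of_bool/rec_eq0/rec_v2.
move=> w t; rewrite AVG_yes_count yes_count_learner /=.
have [leN [t0 eqN]] := N_limit w.
have ratrE m : ratr (m%:R / (size w)%:R) = m%:R / (size w)%:R :> R.
  by rewrite rmorphM fmorphV /= !ratr_nat.
split.
- by rewrite divr_ge0.
- by rewrite ler_wpM2r ?invr_ge0 // ler_nat stage_count_mono.
- by rewrite ratrE ler_wpM2r ?invr_ge0 // ler_nat.
- apply: cvg_near_cst; exists t0 => // t' /= le_t; by rewrite ratrE eqN.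
Qed.

Hypothesis k_summable : forall J, \sum_(0 <= n < J) \sum_(0 <= m < 2 ^ n)
  ((enumerated (str n m) && (0 < k n))%N%:R * 2^-1 ^+ (n - k n) : R) <= 1.

(** The [j]-th yes on behalf of [v] falls on its prefix of length [|v| - k |v| + j]. These prefixes
    cover the set, and their total measure is at most [2 ^ - j] times the Kraft sum in
    [k_summable]. *)
Lemma lambda_learner j :
  (cantor_lambda R (many_yes learner j) <= ((2%:R : R) ^- j)%:E)%E.
Proof.
rewrite -exprVn; case: (posnP j) => [->|j0].
  apply: (@cantor_lambda_le _ _ (fun=> [::]) (pred1 0%N)) => [Y _|n].
    by exists 0%N.
  rewrite big_mkcond; case: n => [|n]; first by rewrite big_geq.
  by rewrite big_nat_recl //= big1_seq ?addr0.
(* [v] runs through all strings, [i.+1 = 2 ^ n + m] naming [str n m]. *)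
pose v i := str (trunc_log 2 i.+1) i.+1.
pose V i := enumerated (v i) && (j <= k (size (v i)))%N.
pose C i := take (size (v i) - k (size (v i)) + j) (v i).
have sizeC i : V i -> size (C i) = (size (v i) - k (size (v i)) + j)%N.
  by move=> /andP[_ jk]; rewrite size_takel //; have := k_le (size (v i)); lia.
apply: (@cantor_lambda_le _ _ C V) => [Y /many_yesP [n]|n].
  rewrite yes_count_learner => /(leq_limitP _ j0) [u Au [i]].
  rewrite size_initial leq_min => /andP[iu le_in] [tE hj].
  have [m ltm uE] := str_surj u.
  pose i' := (2 ^ size u + m).-1.
  have i'E : i'.+1 = (2 ^ size u + m)%N by rewrite prednK // addn_gt0 expn_gt0.
  have vE : v i' = u by rewrite /v i'E trunc_log2_addX // str_addX.
  have Vi : V i' by rewrite /V vE Au /=; lia.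
  exists i' => //; rewrite sizeC // /C vE.
  have le_i : (size u - k (size u) + j <= i)%N by have := k_le (size u); lia.
  by rewrite -(take_initial Y le_i) -(take_initial Y le_in) -tE take_takel.
(* The partial sum is enlarged to consist of complete blocks of strings of equal length. *)
apply: (@le_trans _ _ (\sum_(0 <= i < (2 ^ n).-1 | V i) 2^-1 ^+ size (C i))).
  have le_n : (n <= (2 ^ n).-1)%N by have := ltn_expl n (leqnn 2); lia.
  rewrite [leRHS](big_cat_nat (leq0n n) le_n) /= lerDl; apply: sumr_ge0 => i _.
  by rewrite exprn_ge0 // invr_ge0.
pose G i := (V i.-1)%:R * 2^-1 ^+ (size (v i.-1) - k (size (v i.-1)) + j) : R.
have -> : \sum_(0 <= i < (2 ^ n).-1 | V i) 2^-1 ^+ size (C i) =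
          \sum_(0 <= i < (2 ^ n).-1) G i.+1.
  rewrite big_mkcond; apply: eq_bigr => i _; rewrite /G /=.
  by case: ifP => Vi; rewrite ?mul0r // mul1r sizeC.
rewrite sum_dyadic_blocks.
apply: le_trans (_ : 2^-1 ^+ j * 1 <= _); last by rewrite mulr1.
apply: le_trans (ler_wpM2l _ (k_summable n)); last by rewrite exprn_ge0 // invr_ge0.
rewrite mulr_sumr; apply: ler_sum => n' _; rewrite mulr_sumr.
rewrite big_nat_cond [leRHS]big_nat_cond; apply: ler_sum => m /andP[/andP[_ ltm] _].
have vE : v (2 ^ n' + m).-1 = str n' m.
  by rewrite /v prednK ?addn_gt0 ?expn_gt0 // trunc_log2_addX // str_addX.
rewrite /G /V vE size_str exprD [leRHS]mulrCA [_ ^+ j * _]mulrC.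
rewrite ler_wpM2r ?mulr_ge0 ?exprn_ge0 ?invr_ge0 //.
rewrite ler_nat; case: (enumerated _) => //=.
by case: (leqP j (k n')) => // /(leq_trans j0) ->.
Qed.
End EnumerableLearner.

Lemma enumerable_learner (R : realType) (P : seq bool * nat -> bool) (k : nat -> nat) :
  rec (fun e : ctx 3 => P (str e.1.1.2 e.1.2, e.2)) ->
  rec (fun e : ctx 1 => k e.2) ->
  (forall v t, P (v, t) -> P (v, t.+1)) ->
  (forall n, (k n <= n)%N) ->
  (forall J, \sum_(0 <= n < J) \sum_(0 <= m < 2 ^ n)
     ((enumerated P (str n m) && (0 < k n))%N%:R * 2^-1 ^+ (n - k n) : R) <= 1) ->
  exists l : learning_function, [/\ lower_semicomputable (@AVG R l),
    forall j, (cantor_lambda R (many_yes l j) <= ((2%:R : R) ^- j)%:E)%E &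
    forall v, enumerated P v -> (k (size v) <= yes_count l v)%N].
Proof.
move=> cP ck mono k_le k_sum; have [N hN] := yes_limit_exists mono k_le.
exists (learner N); split.
- exact: (lower_semicomputable_learner cP ck mono k_le R hN).
- exact: (lambda_learner mono k_le hN k_sum).
- exact: (yes_count_enumerated mono k_le hN).
Qed.

(** * From gales to learning functions *)

Lemma dim_set_G_constr (R : realType) (Gamma : set (nat -> bool)) (s s' : R) :
  dim_set Gamma s -> s < s' -> exists2 s1, G_constr Gamma s1 & s1 <= s'.
Proof.
move=> [s0 [d [[d0 dD] [g [cg gP]] dX]]] lt_ss'.
(* For [s' >= 1], order 1 asks only for a nonnegative upper limit, which the learner of the empty
   enumeration attains. *)
have [le1s'|lt_s'1] := leP 1 s'.
  exists 1 => //; split=> //.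
  have [||||J|l [semil lambl _]] := @enumerable_learner R (fun=> false) (fun=> 0%N).
  - exact: (rec_const_nat 3 0).
  - exact: rec_const_nat.
  - by [].
  - by [].
  - by rewrite big1 // => n _; rewrite big1 // => m _; rewrite andbF mul0r.
  exists l => X _; split=> //; rewrite subrr.
  by apply: limn_esup_ge => N; exists N => //; rewrite lee_fin AVG_yes_count divr_ge0.
have [q /andP[lt_q q_lt]] : exists q : rat, 1 - s' < ratr q < 1 - s.
  by apply: rat_between; rewrite ltrD2l ltrN2.
have q0R : 0 < ratr q :> R by lra.
have q0 : 0 < q by rewrite -(ltr0q R).
pose a := `|numq q|%N; pose b := `|denq q|%N.
have b0 : (0 < b)%N by rewrite absz_gt0 denq_neq0.
have b0R : 0 < b%:R :> R by rewrite ltr0n.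
have qE : q = a%:R / b%:R.
  by rewrite /a /b !natr_absz !ger0_norm ?numq_ge0 ?divq_num_den // ltW.
have qER : ratr q = a%:R / b%:R :> R by rewrite {1}qE rmorphM fmorphV /= !ratr_nat.
have le_ab : (a <= b)%N.
  rewrite -(ler_nat R) -[leRHS]mul1r -ler_pdivrMr // -qER; lra.
have two0 : 2 != 0 :> R by [].
have ln2 : 0 < ln 2 :> R by rewrite ln_gt0 // ltr1n.
have le1two : 1 <= 2 :> R by rewrite ler1n.
(* Length [n] will contribute at most [2 ^ - c * d [::] * x ^ n] to the Kraft sum, and [q < 1 - s]
   makes [x < 1]. *)
pose x : R := powR 2 (s - 1 + ratr q).
have x1 : x < 1.
  rewrite /x /powR (negPf two0) -[ltRHS]expR0 ltr_expR pmulr_llt0 //; lra.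
have x0 : 0 <= x by exact: powR_ge0.
(* Lowering the target number of answers by [c] divides the bound [d [::] / (1 - x)] by [2 ^ c],
   bringing it to at most 1. *)
have [c hc] := @expr_unbounded R (d [::] / (1 - x)) 2 (ltr1n _ 2).
pose k n := (a * n %/ b - c)%N.
have k_le n : (k n <= n)%N.
  apply: leq_trans (leq_subr _ _) _; rewrite -[leqRHS](mulKn n b0) leq_div2r //.
  by rewrite leq_mul2r le_ab orbT.
pose P vt := 1%:R / 1%:R < g vt.
have PE v t : P (v, t) = (1 < g (v, t)) by rewrite /P divr1.
have P_d v : enumerated P v -> 1 < d v.
  move=> /asboolP [t]; rewrite PE -(ltr_rat R) rmorph1 => /lt_le_trans; apply.
  by have [] := gP v t.
have k_ge n : ratr q * n%:R - (1 + c%:R) <= (k n)%:R :> R.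
  have h1 : (a * n %/ b)%:R <= (k n)%:R + c%:R :> R.
    by rewrite -natrD ler_nat /k addnC -maxnE leq_maxr.
  have h2 : ratr q * n%:R <= (a * n %/ b)%:R + 1 :> R.
    rewrite qER mulrAC ler_pdivrMr // natr1 -!natrM ler_nat.
    by apply: ltnW; rewrite -ltn_divLR.
  lra.
have [||||J|l [semil lambl l_ge]] := @enumerable_learner R P k.
- apply: rec_ltq => // [e|]; first by have [] := gP (str e.1.1.2 e.1.2) e.2.
  by apply: (computable_strnat_rec (n := 3)) => //; [exact: rec_v2|exact: rec_v1|exact: rec_v0].
- apply: rec_sub; last exact: rec_const_nat.
  apply: rec_divn; last exact: rec_const_nat.
  exact: rec_mul (rec_const_nat _ _) (rec_v0 _).
- by move=> v t; rewrite !PE => /lt_le_trans; apply; have [] := gP v t.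
- exact: k_le.
- have dsum n : \sum_(0 <= m < 2 ^ n) d (str n m) * powR 2 (- (s * n%:R)) = d [::].
    pose f w := d w * powR 2 (- (s * (size w)%:R)).
    have fD w : f w = f (rcons w false) + f (rcons w true).
      by rewrite /f !size_rcons -dD.
    have := sum_str_additive n fD; rewrite {2}/f /= mulr0 oppr0 powRr0 mulr1 => <-.
    by apply: eq_bigr => m _; rewrite /f size_str.
  have two_x n : (0 < k n)%N ->
      2^-1 ^+ (n - k n) <= powR 2 (- (s * n%:R)) * (2^-1 ^+ c * x ^+ n) :> R.
    move=> k0; rewrite !exprVn -!powR_mulrn ?powR_ge0 // /x -powRrM -!powRN.
    rewrite -!powRD ?two0 ?implybT //; apply: ler_powR => //.
    have : (k n)%:R + c%:R <= ratr q * n%:R :> R.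
      rewrite qER mulrAC ler_pdivlMr // -natrD -!natrM ler_nat.
      have -> : (k n + c = a * n %/ b)%N by rewrite subnK // ltnW // -subn_gt0.
      exact: leq_trunc_div.
    have nk : (n - k n)%:R = n%:R - (k n)%:R :> R by rewrite natrB.
    by rewrite nk !mulrDl mulN1r; lra.
  have pos n : 0 <= 2^-1 ^+ c * x ^+ n by rewrite mulr_ge0 ?exprn_ge0 ?invr_ge0.
  apply: (@le_trans _ _ (\sum_(0 <= n < J) d [::] * (2^-1 ^+ c * x ^+ n))).
    apply: ler_sum => n _; rewrite -(dsum n) mulr_suml; apply: ler_sum => m _.
    (* Enumerated strings have [d > 1], so weighting their terms by [d] only enlarges the sum, which
       the gale equation then evaluates. *)
    case: (boolP (_ && _)) => [/andP[/P_d d1 k0]|_]; last first.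
      by rewrite mul0r !mulr_ge0 ?exprn_ge0 ?invr_ge0 ?powR_ge0.
    rewrite mul1r; apply: le_trans (two_x n k0) _.
    rewrite -mulrA; apply: ler_peMl; last exact: ltW.
    by rewrite mulr_ge0 ?powR_ge0.
  under eq_bigr do rewrite mulrA; rewrite -mulr_sumr.
  apply: (@le_trans _ _ (d [::] * 2^-1 ^+ c * (1 - x)^-1)).
    by rewrite ler_wpM2l ?geometric_sum_le // mulr_ge0 ?exprn_ge0 ?invr_ge0.
  by rewrite mulrAC exprVn ler_pdivrMr ?exprn_gt0 // mul1r; apply: hc.
exists s' => //; split; first by lra.
exists l => X GX; split=> //; apply: limn_esup_ge => N.
pose eps := ratr q - (1 - s').
have eps0 : 0 < eps by rewrite subr_gt0.
(* Beyond [K] the surplus [eps * n] pays for the constant [c] and for rounding down. *)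
have [K hK] : exists K : nat, (1 + c%:R) / eps <= K%:R.
  by exists (Num.truncn ((1 + c%:R) / eps)).+1; apply/ltW/truncnS_gt.
have lt_esup : (1%:E < limn_esup (fun n => (d (prefix X n))%:E))%E.
  by rewrite (dX X GX) ltry.
have [n] := limn_esup_gt lt_esup (maxn N K.+1); rewrite lte_fin geq_max => /andP[Nn Kn] dn.
exists n => //; rewrite lee_fin AVG_yes_count size_initial.
have n0 : 0 < n%:R :> R by rewrite ltr0n; exact: leq_ltn_trans Kn.
rewrite ler_pdivlMr //.
have enumX : enumerated P (prefix X n).
  have [_ _ _ cvgg] := gP (prefix X n) 0%N.
  have /cvgrPdist_lt /(_ _ (_ : 0 < d (prefix X n) - 1)) := cvgg.
  rewrite subr_gt0 => /(_ dn) [t _ /(_ t (leqnn t))] /= dist.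
  apply/asboolP; exists t; rewrite PE -(ltr_rat R) rmorph1.
  by move: dist => /ltr_normlP [_]; lra.
have := l_ge _ enumX; rewrite size_initial -(ler_nat R) => le_k.
have : (1 + c%:R) <= eps * n%:R.
  rewrite mulrC -ler_pdivrMr //; by apply: le_trans hK _; rewrite ler_nat ltnW.
have := k_ge n; rewrite /eps; lra.
Qed.

Theorem mainTheorem7 (R : realType) (Gamma : set (nat -> bool)) :
  @alg_dim R Gamma = ereal_inf [set s%:E | s in @G_constr R Gamma].
Proof.
(* Infima compare as soon as each member of [A] is matched in [B] up to arbitrarily small slack;
   this slack is what the two directions consume. *)
have inf_le (A B : set R) :
    (forall s s', A s -> s < s' -> exists2 s1, B s1 & s1 <= s') ->
    (ereal_inf [set s%:E | s in B] <= ereal_inf [set s%:E | s in A])%E.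
  move=> AB; apply: le_ereal_inf_tmp => _ [s As <-]; apply/lee_addgt0Pr => e e0.
  have lt_se : s < s + e by rewrite ltrDl.
  have [s1 Bs1 le_s1] := AB _ _ As lt_se.
  by apply: ge_ereal_inf; exists s1%:E; [exists s1 | rewrite lee_fin].
apply/eqP; rewrite eq_le; apply/andP; split; apply: inf_le => s s' hs lt_ss'.
  exact: G_constr_dim_set lt_ss'.
exact: dim_set_G_constr lt_ss'.
Qed.
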